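(* Let $Y,V$ be separable Hilbert spaces ($V$ infinite-dimensional), let $\Omega$ be a compact metric space, let $\mu$ be a Borel probability measure on $\Omega\times Y$ with $\mathbb{E}(\|y\|_Y^2)=\int_{\Omega\times Y}\|y\|_Y^2\,d\mu(\omega,y)<\infty$, and let $\rho$ be the marginal Borel probability measure on $\Omega$ induced by $\mu$. Let $\mathbf{R}=\{R_\omega\}_{\omega\in\Omega}$ be a family of bounded linear operators $R_\omega:Y\to V$ which is weakly measurable (i.e. $\omega\mapsto(R_\omega y,v)_V$ is Borel measurable on $\Omega$ for each $(y,v)\in Y\times V$) and satisfies $\|R_\omega\|_{Y\to V}^2\le\Lambda<\infty$ for all $\omega\in\Omega$. Assume that $P_\rho=\mathbb{E}(R_\omega R_\omega^\ast):V\to V$ is injective and compact. Suppose that $$g:=\mathbb{E}(R_\omega y)\notin\mathrm{ran}(P_\rho).$$ Let $(\omega_m,y_m)$, $m=0,1,2,\ldots$, be i.i.d. random samples with respect to $\mu$, let $u^{(0)}\in V$ be arbitrary, and define $$u^{(m+1)}=\alpha_m\bigl(u^{(m)}+\mu_m R_{\omega_m}(y_m-R_{\omega_m}^\ast u^{(m)})\bigr),\qquad \alpha_m=\frac{m+1}{m+2},\quad \mu_m=\frac{A}{(m+1)^t},\qquad m=0,1,2,\ldots .$$ Then, for any choice of the parameters $1/2<t<1$ and $0<A\le 1/(2\Lambda)$, $$\|\mathbb{E}(u^{(m)})\|_V^2\to\infty,\qquad m\to\infty .$$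
   Context: Here $R_\omega^\ast:V\to Y$ is the Hilbert adjoint of $R_\omega$. $P_\rho$ is the bounded self-adjoint nonnegative operator on $V$ determined by $(P_\rho v,w)_V=\int_\Omega(R_\omega^\ast v,R_\omega^\ast w)_Y\,d\rho(\omega)$ for all $v,w\in V$, and $\mathbb{E}(R_\omega y)\in V$ is the Bochner integral $\int_{\Omega\times Y}R_\omega y\,d\mu(\omega,y)$. The element $\mathbb{E}(u^{(m)})\in V$ is the ($V$-valued) expectation of $u^{(m)}$ over the random samples $(\omega_0,y_0),\ldots,(\omega_{m-1},y_{m-1})$; $u^{(0)}$ is deterministic. *)

(* Defs.v *)
From HB Require Import structures.
From mathcomp Require Import all_boot all_order all_algebra.
From mathcomp Require Import finmap.
From mathcomp Require Import all_classical all_reals all_analysis.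

Set Implicit Arguments.
Unset Strict Implicit.
Unset Printing Implicit Defensive.

Import Order.TTheory GRing.Theory Num.Theory.
Import numFieldNormedType.Exports.

Local Open Scope classical_set_scope.
Local Open Scope ring_scope.

(* Measurable types are pointed in the library, so a metric space carrying its
   Borel sigma-algebra has to be pointed as well; the point plays no role. *)
#[short(type="pmetricType")]
HB.structure Definition PMetric (K : numDomainType) :=
  { M of Metric K M & Pointed M }.

Notation borel X := (g_sigma_algebraType (@open X)).

Definition separable (T : topologicalType) : Prop :=
  exists2 D : set T, countable D & dense D.

(* A real Hilbert space is a complete normed module together with a symmetric
   positive definite bilinear form [ip] satisfying [hilbert_norm ip]. *)
Definition hilbert_norm (R : realType) (V : completeNormedModType R)
    (ip : {dot V for idfun}) : Prop :=
  forall v, ip v v = `|v| ^+ 2.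

Definition infinite_dimensional (R : realType) (V : lmodType R) : Prop :=
  ~ exists (n : nat) (e : 'I_n -> V),
      forall v, exists c : 'I_n -> R, v = \sum_(i < n) c i *: e i.

Definition opnorm (R : realType) (Y V : normedModType R) (A : Y -> V) : R :=
  sup [set `|A y| | y in [set y | `|y| <= 1]].

Definition is_adjoint (R : realType) (Y V : completeNormedModType R)
    (ipY : {dot Y for idfun}) (ipV : {dot V for idfun})
    (A : Y -> V) (B : V -> Y) : Prop :=
  forall y v, ipV (A y) v = ipY y (B v).

Definition compact_operator (R : realType) (V W : normedModType R)
    (A : V -> W) : Prop :=
  precompact (A @` [set v | `|v| <= 1]).

Section bochner.
Context d (T : measurableType d) (R : realType) (V : completeNormedModType R).
Variable mu : probability T R.

Definition simple_integral (s : T -> V) : V :=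
  \sum_(v \in range s) fine (mu (s @^-1` [set v])) *: v.

Definition is_bochner_integral (f : T -> V) (x : V) : Prop :=
  exists s : nat -> {fimfun T >-> V},
    [/\ forall n v, measurable (s n @^-1` [set v]),
        {ae mu, forall t, s n t @[n --> \oo] --> f t},
        (\int[mu]_t (`|f t - s n t|)%:E)%E @[n --> \oo] --> 0%E
      & simple_integral (s n) @[n --> \oo] --> x].

(* The value is 0 when [f] is not Bochner integrable. *)
Definition bochner (f : T -> V) : V := xget 0 [set x | is_bochner_integral f x].

End bochner.

Definition mutually_independent d d' (T : measurableType d)
    (S : measurableType d') (R : realType) (P : probability T R)
    (X : nat -> {mfun T >-> S}) : Prop :=
  forall (J : {fset nat}) (A : nat -> set S),
    (forall i, measurable (A i)) ->
    P (\bigcap_(i in [set` J]) (X i @^-1` A i)) =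
    (\prod_(i <- J) P (X i @^-1` A i))%E.

Definition iid d d' (T : measurableType d) (S : measurableType d')
    (R : realType) (P : probability T R) (mu : probability S R)
    (X : nat -> {mfun T >-> S}) : Prop :=
  mutually_independent P X /\
  forall m (B : set S), measurable B -> distribution P (X m) B = mu B.

Definition marginal (R : realType) (Omega : pmetricType R)
    (Y : completeNormedModType R)
    (mu : probability (borel (Omega * Y)%type) R) : set (borel Omega) -> \bar R :=
  pushforward mu (fst : borel (Omega * Y)%type -> borel Omega).

(* [Prho] is E(R_w R_w^* ) in the weak sense. *)
Definition is_mean_operator (R : realType) (Omega : pmetricType R)
    (Y V : completeNormedModType R)
    (ipY : {dot Y for idfun}) (ipV : {dot V for idfun})
    (rho : set (borel Omega) -> \bar R) (Radj : Omega -> V -> Y)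
    (Prho : V -> V) : Prop :=
  forall v v', ((ipV (Prho v) v')%:E =
    \int[rho]_w (ipY (Radj w v) (Radj w v'))%:E)%E.

Fixpoint iterates (R : realType) (Omega : Type) (Y V : lmodType R)
    (Rop : Omega -> Y -> V) (Radj : Omega -> V -> Y) (alpha step : nat -> R)
    (u0 : V) (z : nat -> Omega * Y) (m : nat) : V :=
  if m is k.+1 then
    let u := iterates Rop Radj alpha step u0 z k in
    alpha k *: (u + step k *: Rop (z k).1 ((z k).2 - Radj (z k).1 u))
  else u0.

(* Main.v *)
(** The Bochner means [x_m = E u^(m)] satisfy the deterministic recursion
    [x_(m+1) = alpha_m (x_m + mu_m (g - P_rho x_m))], because [u^(m)] depends only
    on the first [m] samples and is therefore independent of [(omega_m, y_m)].
    With [q_m = (m+1) (g - P_rho x_m)] this reads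
    [q_(m+1) = (I - mu_m P_rho) q_m + g], where [I - mu_m P_rho] is nonexpansive.
    As [P_rho] is injective and self-adjoint, its range is dense; writing
    [g = P_rho h + e] with [e] small and comparing [q_m] with [h / mu_m] gives
    [|q_m| <= C + 2 |h| / mu_m + m |e|], and since [m mu_m] tends to infinity,
    [P_rho x_m] converges to [g] in norm.  If [|x_m|] stayed bounded along a
    subsequence, the nested convex sets [{v : |g - P_rho v| <= 1/n}] would contain
    bounded points, and their elements of almost minimal norm would converge to a
    preimage of [g]. *)

Require Import Defs.
From HB Require Import structures.
From mathcomp Require Import all_boot all_order all_algebra.
From mathcomp Require Import finmap.
From mathcomp Require Import all_classical all_reals all_analysis.
From mathcomp Require Import measurable_realfun ring lra.

Set Implicit Arguments.
Unset Strict Implicit.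
Unset Printing Implicit Defensive.

Import Order.TTheory GRing.Theory Num.Theory.
Import numFieldNormedType.Exports.

Local Open Scope classical_set_scope.
Local Open Scope ring_scope.

(** * Hilbert space geometry and the averaged iteration *)

Section hilbert.
Context {R : realType} {V : completeNormedModType R} {ip : {dot V for idfun}}.
Implicit Types (u v w : V) (a : R).

Lemma ipC u v : ip u v = ip v u.
Proof. by rewrite hermitian_subproof expr0 mul1r. Qed.
Lemma ipDl u v w : ip (u + v) w = ip u w + ip v w.
Proof. by rewrite linearDl. Qed.
Lemma ipDr u v w : ip u (v + w) = ip u v + ip u w.
Proof. by rewrite linearDr. Qed.
Lemma ipBl u v w : ip (u - v) w = ip u w - ip v w.
Proof. by rewrite linearBl. Qed.
Lemma ipBr u v w : ip u (v - w) = ip u v - ip u w.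
Proof. by rewrite linearBr. Qed.
Lemma ipNl u v : ip (- u) v = - ip u v.
Proof. by rewrite linearNl. Qed.
Lemma ipZl a u v : ip (a *: u) v = a * ip u v.
Proof. by rewrite linearZl_LR. Qed.
Lemma ipZr a u v : ip u (a *: v) = a * ip u v.
Proof. by rewrite linearZr_LR. Qed.
Lemma ip0l u : ip 0 u = 0.
Proof. by rewrite linear0l. Qed.
Lemma ip0r u : ip u 0 = 0.
Proof. by rewrite linear0r. Qed.

Hypothesis hilb : hilbert_norm ip.

Lemma ip_ge0 u : 0 <= ip u u.
Proof. by rewrite hilb sqr_ge0. Qed.

Lemma cauchy_schwarz u v : `|ip u v| <= `|u| * `|v|.
Proof.
have [->|v0] := eqVneq v 0; first by rewrite ip0r !normr0 mulr0.
have nv : 0 < `|v| ^+ 2 by rewrite exprn_gt0// normr_gt0.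
have := ip_ge0 (`|v| ^+ 2 *: u - ip u v *: v).
rewrite ipBl !ipBr !ipZl !ipZr !hilb (ipC v u) => H.
have {}H : 0 <= `|v| ^+ 2 * (`|u| ^+ 2 * `|v| ^+ 2 - ip u v ^+ 2).
  by apply: le_trans H _; rewrite le_eqVlt; apply/orP; left; apply/eqP; ring.
rewrite pmulr_rge0// subr_ge0 -exprMn in H.
rewrite -(@ler_pXn2r _ 2)// ?nnegrE ?mulr_ge0//.
by rewrite -normrX ger0_norm ?sqr_ge0.
Qed.

Lemma ip_le u v : ip u v <= `|u| * `|v|.
Proof. exact: le_trans (ler_norm _) (cauchy_schwarz _ _). Qed.

Lemma ip_ext u v : (forall w, ip u w = ip v w) -> u = v.
Proof.
move=> H; apply/eqP; rewrite -subr_eq0 -normr_eq0 -sqrf_eq0 -hilb.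
by rewrite ipBl H subrr.
Qed.

Lemma ip_continuous v : continuous (fun u => ip u v).
Proof.
move=> u; apply/cvgrPdist_lt => e e0.
(* The added 1 keeps the denominator positive when [v] is 0; the same device recurs below. *)
have d0 : 0 < e / (`|v| + 1) by rewrite divr_gt0 ?ltr_wpDl.
near=> w.
have uw : `|u - w| < e / (`|v| + 1) by near: w; exact: cvgr_dist_lt.
rewrite -ipBl (le_lt_trans (cauchy_schwarz _ _))//.
rewrite (@le_lt_trans _ _ (`|u - w| * (`|v| + 1))) ?ler_wpM2l ?lerDl//.
by rewrite -ltr_pdivlMr// ltr_wpDl.
Unshelve. all: by end_near. Qed.

Lemma parallelogram u v :
  `|u - v| ^+ 2 = 2 * `|u| ^+ 2 + 2 * `|v| ^+ 2 - 4 * `|2^-1 *: (u + v)| ^+ 2.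
Proof.
rewrite -!hilb ipZl ipZr ipBl !ipBr ipDl !ipDr (ipC v u).
by field.
Qed.

(* A substitute for weak compactness: points of almost minimal norm in the sets
   form a Cauchy sequence, by the parallelogram law. *)
Lemma nested_midpoint_convex (C : nat -> set V) (M : R) :
  (forall n m, (n <= m)%N -> C m `<=` C n) ->
  (forall n x y, C n x -> C n y -> C n (2^-1 *: (x + y))) ->
  (forall n, exists2 x, C n x & `|x| <= M) ->
  exists e, (exists2 x : nat -> V, (forall n, C n (x n)) &
                x n @[n --> \oo] --> e) /\
    forall c, (forall n, C n c) -> `|e| <= `|c|.
Proof.
move=> Cle Cmid CM.
pose N n : set R := [set `|x| | x in C n].
pose d n := inf (N n).
have N0 n : N n !=set0 by have [x Cx _] := CM n; exists `|x|, x.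
have lbN n : lbound (N n) 0 by move=> _ [x _ <-].
have hN n : has_inf (N n) by split => //; exists 0.
have dle n x : C n x -> d n <= `|x|.
  by move=> Cx; apply: ge_inf; [exists 0|exists x].
have dM n : d n <= M by have [x /dle dx xM] := CM n; exact: le_trans xM.
have d0 n : 0 <= d n by apply: lb_le_inf.
have dnd : nondecreasing_seq d.
  move=> n m nm; apply: lb_le_inf => // _ [x Cx <-].
  exact/dle/(Cle _ _ nm).
have hx n : exists x, C n x /\ `|x| <= d n + n.+1%:R^-1.
  have i0 : 0 < n.+1%:R^-1 :> R by rewrite invr_gt0.
  have [_ [x Cx <-] xd] := inf_adherent i0 (hN n).
  by exists x; split => //; exact: ltW.
have [x xP] := choice hx.
have dcvg : d n @[n --> \oo] --> sup (range d).
  apply: nondecreasing_cvgn => //; exists M => _ [n _ <-] //.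
set D := sup (range d) in dcvg.
have dD n : d n <= D.
  by apply: ub_le_sup; [exists M => _ [k _ <-]|exists n].
have D0 : 0 <= D := le_trans (d0 0) (dD 0).
(* Both points have norm at most D + 1/(n+1), and by nestedness their midpoint lies in [C n], so its
   norm is at least [d n]. The parallelogram law turns this into a bound on their distance. *)
have close n m : (n <= m)%N ->
    `|x n - x m| ^+ 2 <= 4 * ((D + n.+1%:R^-1) ^+ 2 - d n ^+ 2).
  move=> nm; rewrite parallelogram.
  have [Cn xn] := xP n; have [/(Cle _ _ nm) Cm xm] := xP m.
  have i0 : 0 <= n.+1%:R^-1 :> R by rewrite invr_ge0.
  have xnD : `|x n| ^+ 2 <= (D + n.+1%:R^-1) ^+ 2.
    rewrite lerXn2r ?nnegrE ?addr_ge0//.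
    by rewrite (le_trans xn)// lerD2r.
  have xmD : `|x m| ^+ 2 <= (D + n.+1%:R^-1) ^+ 2.
    rewrite lerXn2r ?nnegrE ?addr_ge0//.
    by rewrite (le_trans xm)// lerD// lef_pV2 ?posrE// ler_nat ltnS.
  have dmid : d n ^+ 2 <= `|2^-1 *: (x n + x m)| ^+ 2.
    by rewrite lerXn2r ?nnegrE ?d0//; apply: dle; exact: Cmid.
  move: xnD xmD dmid; move: (_ ^+ 2) (_ ^+ 2) (_ ^+ 2) (_ ^+ 2) (_ ^+ 2).
  by move=> ? ? ? ? ?; lra.
have cvg0 : 4 * ((D + n.+1%:R^-1) ^+ 2 - d n ^+ 2) @[n --> \oo] --> (0 : R).
  have -> : 0 = 4 * ((D + 0) ^+ 2 - D ^+ 2) :> R by ring.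
  apply: cvgM; first exact: cvg_cst.
  apply: cvgB; last by rewrite expr2; exact: cvgM.
  rewrite expr2; under eq_fun do rewrite expr2.
  by apply: cvgM; apply: cvgD; [exact: cvg_cst|exact: cvg_harmonic|
    exact: cvg_cst|exact: cvg_harmonic].
have xcvg : cvg (x n @[n --> \oo]).
  apply: cauchy_cvg; apply: cauchy_exP => eps eps0.
  have /cvgrPdist_lt/(_ _ (exprn_gt0 2 eps0)) [K _ HK] := cvg0.
  exists (x K); exists K => // m /= Km.
  rewrite -ball_normE /ball_/= -(@ltr_pXn2r _ 2)// ?nnegrE ?(ltW eps0)//.
  apply: le_lt_trans (close _ _ Km) _.
  have := HK K (leqnn K); rewrite sub0r normrN; apply: le_lt_trans.
  exact: ler_norm.
exists (lim (x n @[n --> \oo])); split.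
  by exists x => // n; case: (xP n).
move=> c Cc.
have cn : `|x n| @[n --> \oo] --> `|lim (x n @[n --> \oo])| by exact: cvg_norm.
have -> : `|c| = `|c| + 0 by rewrite addr0.
apply: (ler_cvg_to cn (_ : `|c| + n.+1%:R^-1 @[n --> \oo] --> `|c| + 0)).
  by apply: cvgD; [exact: cvg_cst|exact: cvg_harmonic].
near=> n; have [_ xn] := xP n.
by rewrite (le_trans xn)// lerD2r dle.
Unshelve. all: by end_near. Qed.

Lemma scaler_halfD u : 2^-1 *: (u + u) = u.
Proof.
rewrite scalerDr -scalerDl (_ : 2^-1 + 2^-1 = 1 :> R) ?scale1r//.
by field.
Qed.

(** * Bounded positive self-adjoint operators *)

Section operator.
Variables (P : {linear V -> V}) (L : R).
Hypotheses (L0 : 0 < L) (Psym : forall v w, ip (P v) w = ip v (P w)).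
Hypotheses (Ppos : forall v, 0 <= ip (P v) v) (PL : forall v, `|P v| <= L * `|v|).

Let PB v w : P (v - w) = P v - P w. Proof. exact: raddfB. Qed.
Let PD v w : P (v + w) = P v + P w. Proof. exact: raddfD. Qed.
Let PZ a v : P (a *: v) = a *: P v. Proof. exact: linearZ. Qed.

Lemma bounded_operator_cvg (x : nat -> V) e :
  x n @[n --> \oo] --> e -> P (x n) @[n --> \oo] --> P e.
Proof.
move=> /cvgrPdist_lt xe; apply/cvgrPdist_lt => eps eps0.
have := xe _ (divr_gt0 eps0 L0); apply: filterS => n.
by rewrite -raddfB ltr_pdivlMr// mulrC; apply: le_lt_trans (PL _).
Qed.

(** Positivity is tested on v - P v / L. The term <P(P v), P v> / L^2 is at most |P v|^2 / L, which
    cancels half of the cross term -2 |P v|^2 / L. *)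
Lemma positive_operator_norm2 v : `|P v| ^+ 2 <= L * ip (P v) v.
Proof.
have := Ppos (v - L^-1 *: P v).
rewrite PB PZ ipBl !ipBr !ipZl !ipZr hilb.
rewrite (Psym (P v)) hilb => H.
have PP : ip (P (P v)) (P v) <= L * `|P v| ^+ 2.
  by rewrite (le_trans (ip_le _ _))// expr2 mulrA ler_wpM2r.
have {PP} : L^-1 * (L^-1 * ip (P (P v)) (P v)) <= L^-1 * `|P v| ^+ 2.
  rewrite ler_wpM2l ?invr_ge0 ?(ltW L0)//.
  by rewrite mulrC ler_pdivrMr// mulrC.
by move=> H2; rewrite -ler_pdivrMl//; lra.
Qed.

(** Expanding the square gives |v|^2 - 2a <P v, v> + a^2 |P v|^2, and [positive_operator_norm2] with
    [a * L <= 1] bounds the last term by a <P v, v>. *)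
Lemma richardson_nonexpansive a v :
  0 <= a -> a * L <= 1 -> `|v - a *: P v| <= `|v|.
Proof.
move=> a0 aL; rewrite -(@ler_pXn2r _ 2)// ?nnegrE//.
rewrite -!hilb ipBl !ipBr !ipZl !ipZr (ipC v) (hilb (P v)).
have h1 := positive_operator_norm2 v; have h2 := Ppos v.
have h3 : a * (a * `|P v| ^+ 2) <= a * ip (P v) v.
  rewrite ler_wpM2l// (le_trans (ler_wpM2l a0 h1))//.
  by rewrite mulrA ler_piMl.
have h4 : 0 <= a * ip (P v) v by rewrite mulr_ge0.
lra.
Qed.

Lemma injective_dense_range g (eps : R) : injective P -> 0 < eps ->
  exists h, `|g - P h| < eps.
Proof.
move=> Pinj eps0.
(* The family of sets is constant, equal to g - ran P; it contains [g] itself, which supplies the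
   norm bound. *)
have [||n|e [[x xC xe] emin]] :=
  @nested_midpoint_convex (fun=> [set g - P h | h in setT]) `|g|.
- by move=> *.
- move=> _ _ _ [h _ <-] [k _ <-]; exists (2^-1 *: (h + k)) => //.
  rewrite linearZ linearD/= addrACA -opprD scalerBr.
  by rewrite scaler_halfD scalerDr.
- by exists g => //; exists 0 => //; rewrite raddf0 subr0.
suff e0 : e = 0.
  rewrite e0 in xe; have /cvgrPdist_lt/(_ _ eps0) [K _ HK] := xe.
  have := HK K (leqnn K); rewrite sub0r normrN.
  by have [h _ <-] := xC K; exists h.
apply: Pinj; rewrite raddf0; apply/eqP.
rewrite -normr_eq0 -sqrf_eq0.
set b := `|P e| ^+ 2.
(* [e] is the shortest vector in the closure of [g - ran P], hence orthogonal to
   [ran P]; this is tested on the multiples of [P (P e)]. *)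
have min s : ip e e <= ip (e - P (s *: P e)) (e - P (s *: P e)).
  rewrite !hilb lerXn2r ?nnegrE//.
  have lc : `|x n - P (s *: P e)| @[n --> \oo] --> `|e - P (s *: P e)|.
    by apply: cvg_norm; apply: cvgB => //; exact: cvg_cst.
  apply: (ler_cvg_to (cvg_cst `|e|) lc); apply: nearW => n.
  apply: emin => _; have [h _ <-] := xC n; exists (h + s *: P e) => //.
  by rewrite raddfD/= opprD addrA.
have b0 : 0 <= b by exact: sqr_ge0.
have key s : 0 <= s -> 2 * s * b <= s ^+ 2 * (L ^+ 2 * b).
  move=> s0; have := min s.
  rewrite PZ ipBl !ipBr !ipZl !ipZr (ipC _ e) -Psym !hilb -/b.
  have : `|P (P e)| ^+ 2 <= L ^+ 2 * b.
    by rewrite -exprMn lerXn2r ?nnegrE ?mulr_ge0 ?(ltW L0).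
  move=> /(ler_wpM2l (sqr_ge0 s)); lra.
have L20 : 0 < L ^+ 2 by rewrite exprn_gt0.
(* At s = 1/L^2 the inequality [key] reads 2b/L^2 <= b/L^2, forcing b = 0. *)
have := key (L ^+ 2)^-1; rewrite invr_ge0 (ltW L20) => /(_ erefl).
have -> : (L ^+ 2)^-1 ^+ 2 * (L ^+ 2 * b) = (L ^+ 2)^-1 * b.
  by field; rewrite gt_eqF.
rewrite -mulrA -subr_le0 => H.
have : (L ^+ 2)^-1 * b <= 0 by lra.
by rewrite pmulr_rle0 ?invr_gt0// => b0'; rewrite eq_le b0 b0'.
Qed.

(** * The deterministic averaged iteration *)

Section averaged_iteration.
Variables (g : V) (mu : nat -> R) (x : nat -> V).
Hypothesis mu_gt0 : forall m, 0 < mu m.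
Hypothesis muL : forall m, mu m * L <= 1.
Hypothesis mu_noninc : forall m, mu m.+1 <= mu m.
Hypothesis mu_slow : (m.+1%:R * mu m)^-1 @[m --> \oo] --> (0 : R).
Hypothesis xS : forall m,
  x m.+1 = (m.+1%:R / m.+2%:R) *: (x m + mu m *: (g - P (x m))).

Let q m := m.+1%:R *: (g - P (x m)).

Let qS m : q m.+1 = q m - mu m *: P (q m) + g.
Proof.
(* Pairing with an arbitrary [w] reduces the vector identity to a scalar one that [field] can
   decide. *)
rewrite /q xS !PZ PD PZ; apply: ip_ext => w.
rewrite !(ipDl, ipNl, ipZl).
have := ltr0Sn R m.+1; rewrite -(natr1 m.+1); move: (m.+1%:R) => c c0.
by field; rewrite gt_eqF.
Qed.

(** The vector h / mu_m is almost fixed by the recursion for [q]: one step adds only g - P h. The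
    other error is the drift of h / mu_m with m, whose norms telescope because [mu] is
    nonincreasing. *)
Let q_bound (h : V) m : `|q m - (mu m)^-1 *: h| <=
  `|q 0 - (mu 0)^-1 *: h| + ((mu m)^-1 - (mu 0)^-1) * `|h|
   + m%:R * `|g - P h|.
Proof.
elim: m => [|m IH]; first by rewrite subrr !mul0r !addr0.
have -> : q m.+1 - (mu m.+1)^-1 *: h =
   (q m - (mu m)^-1 *: h) - mu m *: P (q m - (mu m)^-1 *: h)
   + (g - P h) - ((mu m.+1)^-1 - (mu m)^-1) *: h.
  rewrite qS PB (PZ _ h); apply: ip_ext => w.
  by rewrite !(ipDl, ipNl, ipZl); field; rewrite !gt_eqF.
have hn := richardson_nonexpansive (q m - (mu m)^-1 *: h)
  (ltW (mu_gt0 m)) (muL m).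
rewrite (le_trans (ler_normB _ _))// normrZ ger0_norm; last first.
  by rewrite subr_ge0 lef_pV2 ?posrE.
have := ler_normD (q m - (mu m)^-1 *: h - mu m *: P (q m - (mu m)^-1 *: h))
  (g - P h).
rewrite -(natr1 m).
lra.
Qed.

Lemma averaged_residual_cvg0 : injective P -> g - P (x m) @[m --> \oo] --> 0.
Proof.
move=> Pinj; apply/cvgrPdist_lt => eps eps0.
have e3 : 0 < eps / 3 by rewrite divr_gt0.
have [h he] := injective_dense_range g Pinj e3.
set c0 := `|q 0 - (mu 0)^-1 *: h|.
have cv1 : m.+1%:R^-1 * c0 @[m --> \oo] --> (0 : R).
  by rewrite -(mul0r c0); apply: cvgM; [exact: cvg_harmonic|exact: cvg_cst].
have cv2 : (m.+1%:R * mu m)^-1 * (2 * `|h|) @[m --> \oo] --> (0 : R).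
  by rewrite -(mul0r (2 * `|h|)); by apply: cvgM => //; exact: cvg_cst.
have /cvgrPdist_lt/(_ _ e3) n1 := cv1.
have /cvgrPdist_lt/(_ _ e3) n2 := cv2.
near=> m.
have : `|0 - m.+1%:R^-1 * c0| < eps / 3 by near: m.
have : `|0 - (m.+1%:R * mu m)^-1 * (2 * `|h|)| < eps / 3 by near: m.
rewrite !sub0r !normrN => b2 b1.
have {}b1 := le_lt_trans (ler_norm _) b1.
have {}b2 := le_lt_trans (ler_norm _) b2.
have m0 : 0 < m.+1%:R :> R by [].
have -> : g - P (x m) = m.+1%:R^-1 *: q m.
  by rewrite /q scalerA mulVf// scale1r.
rewrite normrZ ger0_norm ?invr_ge0//.
(* Returning from q_m - h / mu_m to q_m costs another |h| / mu_m, hence the factor 2; the negative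
   term with 1 / mu_0 is dropped. *)
have qm : `|q m| <= c0 + (mu m)^-1 * (2 * `|h|) + m.+1%:R * `|g - P h|.
  rewrite -(subrK ((mu m)^-1 *: h) (q m)) (le_trans (ler_normD _ _))//.
  rewrite normrZ ger0_norm ?invr_ge0 ?(ltW (mu_gt0 _))//.
  have := q_bound h m; rewrite -/c0 -(natr1 m).
  have : 0 <= (mu 0)^-1 * `|h| by rewrite mulr_ge0 ?invr_ge0// ltW.
  have : 0 <= `|g - P h| by [].
  lra.
have {}qm : m.+1%:R^-1 * `|q m| <= m.+1%:R^-1 * c0
    + (m.+1%:R * mu m)^-1 * (2 * `|h|) + `|g - P h|.
  rewrite mulrC ler_pdivrMr// (le_trans qm)// le_eqVlt; apply/orP; left.
  by apply/eqP; field; rewrite !gt_eqF.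
rewrite (le_lt_trans qm)//.
have -> : eps = eps / 3 + eps / 3 + eps / 3 :> R by field.
by rewrite !ltrD.
Unshelve. all: by end_near. Qed.

Theorem averaged_iteration_unbounded : injective P -> ~ range P g ->
  `|x m| ^+ 2 @[m --> \oo] --> +oo_R.
Proof.
move=> Pinj gP; have /cvgrPdist_lt r0 := averaged_residual_cvg0 Pinj.
apply: contrapT => xoo; apply: gP.
(* Failure of divergence yields a bound that holds at arbitrarily late indices, where the residual
   is already small. *)
have [M HM] : exists M, forall N, exists2 m, (N <= m)%N & `|x m| ^+ 2 <= M.
  apply: contrapT => nM; apply: xoo; apply/cvgryPge => M.
  apply: contrapT => nb; apply: nM; exists M => N.
  apply: contrapT => nN; apply: nb; exists N => // m /= Nm.
  rewrite leNgt; apply/negP => xm; apply: nN; exists m => //; exact: ltW.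
(* The radius 1 + M comes from the bound M on the squared norm: either |x_m| <= 1, or |x_m| <=
   |x_m|^2 <= M. *)
have [||n|e [[y yC ye] _]] := @nested_midpoint_convex
    (fun n => [set v | `|g - P v| <= n.+1%:R^-1]) (1 + M).
- move=> n m nm v /= vm; rewrite (le_trans vm)//.
  by rewrite lef_pV2 ?posrE// ler_nat ltnS.
- move=> n v w /= vn wn; rewrite linearZ linearD/=.
  have -> : g - 2^-1 *: (P v + P w) = 2^-1 *: ((g - P v) + (g - P w)).
    by rewrite addrACA -opprD [RHS]scalerBr scaler_halfD.
  rewrite normrZ ger0_norm ?invr_ge0// mulrC ler_pdivrMr//.
  by rewrite (le_trans (ler_normD _ _))// mulr_natr mulr2n lerD.
- have [|K _ HK] := r0 n.+1%:R^-1; first by rewrite invr_gt0.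
  have [m Km xm] := HM K; exists (x m).
    by have := HK m Km; rewrite /= sub0r normrN; exact: ltW.
  have [x1|x1] := leP `|x m| 1.
    by rewrite (le_trans x1)// lerDl (le_trans _ xm).
  rewrite (@le_trans _ _ (`|x m| ^+ 2)) ?ler_eXnr ?(ltW x1)//.
  by rewrite (le_trans xm)// lerDr.
exists e => //; apply/eqP; rewrite eq_sym -subr_eq0 -normr_le0.
have lc : `|g - P (y n)| @[n --> \oo] --> `|g - P e|.
  by apply: cvg_norm; apply: cvgB; [exact: cvg_cst|exact: bounded_operator_cvg].
by apply: (ler_cvg_to lc (@cvg_harmonic R)); apply: nearW => n; exact: yC.
Qed.


End averaged_iteration.
End operator.
End hilbert.

(** * Weak measurability and the Bochner integral *)

Lemma separable_dense_seq (R : realType) (V : normedModType R) : separable V ->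
  exists e : nat -> V, forall v (eps : R), 0 < eps -> exists n, `|v - e n| < eps.
Proof.
move=> [D /countable_injP[f finj] Dd].
(* The injection of [D] into the naturals is inverted; an index that codes no point of [D] gets the
   default value 0. *)
exists (fun n => xget 0 [set v | D v /\ f v = n]) => v eps eps0.
have [||w [/interior_subset bw Dw]] := Dd (ball v eps)°.
- by exists v; exact: nbhsx_ballx.
- exact: open_interior.
exists (f w); case: xgetP => [u _ [Du fu]|/(_ w)]; last first.
  by move=> /(_ (conj Dw erefl)).
have -> : u = w by apply: finj; rewrite ?inE.
by move: bw; rewrite -ball_normE.
Qed.

(** * Approximation by finitely many values *)

Section nearest_point.
Context d (T : measurableType d) (R : realType) (V : normedModType R).
Variables (e : nat -> V) (f : T -> V).

(** A running minimiser of the distance to [f t] among 0 and the first [n] points of [e]. Starting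
    from 0 makes the error at most |f t|, the domination used for integrals. *)
Fixpoint nearest (n : nat) (t : T) : V :=
  if n is k.+1 then
    if `|f t - e k| < `|f t - nearest k t| then e k else nearest k t
  else 0.

Lemma nearest_dist_noninc n m t : (n <= m)%N ->
  `|f t - nearest m t| <= `|f t - nearest n t|.
Proof.
elim: m => [|m IH]; first by rewrite leqn0 => /eqP ->.
rewrite leq_eqVlt => /orP[/eqP -> //|/IH]; rewrite /=.
by case: ltP => // h1; apply: le_trans; exact: ltW.
Qed.

Lemma nearest_dist_le n t : `|f t - nearest n t| <= `|f t|.
Proof. by have := nearest_dist_noninc t (leq0n n); rewrite /= subr0. Qed.

Lemma nearest_finite n : finite_set (range (nearest n)).
Proof.
elim: n => [|n IH].
  by apply: (@sub_finite_set _ _ [set 0]) => // _ [t _ <-].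
apply: (@sub_finite_set _ _ (range (nearest n) `|` [set e n])).
  by move=> _ [t _ <-] /=; case: ifP => _; [right|left; exists t].
by rewrite finite_setU.
Qed.

Lemma nearest_cvg : (forall v eps, 0 < eps -> exists n, `|v - e n| < eps) ->
  forall t, nearest n t @[n --> \oo] --> f t.
Proof.
move=> ed t; apply/cvgrPdist_lt => eps /(ed (f t))[k fk].
exists k.+1 => // n kn; apply: le_lt_trans (nearest_dist_noninc t kn) _ => /=.
by case: ifPn => [//|]; rewrite -leNgt => h; exact: le_lt_trans h fk.
Qed.

Hypothesis mf : forall v, measurable_fun setT (fun t => `|f t - v|).

Lemma measurable_nearest_dist n :
  measurable_fun setT (fun t => `|f t - nearest n t|).
Proof.
elim: n => [|n IH] //=.
have -> : (fun t => `|f t - (if `|f t - e n| < `|f t - nearest n t|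
                             then e n else nearest n t)|) =
    (fun t => if `|f t - e n| < `|f t - nearest n t|
              then `|f t - e n| else `|f t - nearest n t|).
  by apply/funext => t; case: ifP.
by apply: measurable_fun_ifT => //; exact: measurable_fun_ltr.
Qed.

(** [nearest] is a finite case split on measurable comparisons, so composition with it stays
    measurable without any sigma-algebra on [V]. The extra argument of [h] serves the Carathéodory
    lemma below. *)
Lemma measurable_comp_nearest (h : T -> V -> R) n :
  (forall v, measurable_fun setT (h^~ v)) ->
  measurable_fun setT (fun t => h t (nearest n t)).
Proof.
move=> mh; elim: n => [|n IH] //=.
have -> : (fun t => h t (if `|f t - e n| < `|f t - nearest n t|
                             then e n else nearest n t)) =
    (fun t => if `|f t - e n| < `|f t - nearest n t|
              then h t (e n) else h t (nearest n t)).
  by apply/funext => t; case: ifP.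
apply: measurable_fun_ifT => //; apply: measurable_fun_ltr => //.
exact: measurable_nearest_dist.
Qed.

Lemma measurable_nearest n v : measurable (nearest n @^-1` [set v]).
Proof.
pose h := fun (_ : T) u => (u == v)%:R : R.
have -> : nearest n @^-1` [set v] = (fun t => h t (nearest n t)) @^-1` [set 1].
  apply/seteqP; split => t; rewrite /h /=; first by move=> ->; rewrite eqxx.
  by case: eqP => // _ /eqP; rewrite eq_sym oner_eq0.
by rewrite -[X in measurable X]setTI; apply: measurable_comp_nearest.
Qed.

End nearest_point.

(** Substituting the approximants [nearest] for [f] gives measurable functions, and continuity in
    the second argument gives pointwise convergence. *)
Lemma measurable_caratheodory d (T : measurableType d) (R : realType)
    (V : normedModType R) (f : T -> V) (h : T -> V -> R) :
  separable V -> (forall v, measurable_fun setT (fun t => `|f t - v|)) ->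
  (forall v, measurable_fun setT (h^~ v)) -> (forall t, continuous (h t)) ->
  measurable_fun setT (fun t => h t (f t)).
Proof.
move=> /separable_dense_seq[e ed] mf mh hc.
apply: (@measurable_fun_cvg _ _ _ _ (fun n t => h t (nearest e f n t))).
  by move=> n; exact: measurable_comp_nearest.
by move=> t _; apply: continuous_cvg; [exact: hc|exact: nearest_cvg].
Qed.

Section weakly_measurable.
Context d (T : measurableType d) (R : realType) (V : completeNormedModType R).
Context (ip : {dot V for idfun}).

Definition weakly_measurable (f : T -> V) :=
  forall v, measurable_fun setT (fun t => ip (f t) v).

Lemma weakly_measurable_cst v : weakly_measurable (cst v).
Proof. by move=> w; exact: (measurable_cst (ip v w)). Qed.

Lemma weakly_measurableD f g : weakly_measurable f -> weakly_measurable g ->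
  weakly_measurable (fun t => f t + g t).
Proof.
by move=> mf mg v; under eq_fun do rewrite ipDl; exact: measurable_funD.
Qed.

Lemma weakly_measurableZ a f : weakly_measurable f ->
  weakly_measurable (fun t => a *: f t).
Proof.
by move=> mf v; under eq_fun do rewrite ipZl; exact: measurable_funM.
Qed.

Lemma weakly_measurableB f g : weakly_measurable f -> weakly_measurable g ->
  weakly_measurable (fun t => f t - g t).
Proof.
by move=> mf mg v; under eq_fun do rewrite ipBl; exact: measurable_funB.
Qed.

Hypotheses (hilb : hilbert_norm ip) (sepV : separable V).

(* Pettis: the norm is a countable supremum of continuous linear functionals. *)
Lemma weakly_measurable_norm f : weakly_measurable f ->
  measurable_fun setT (fun t => `|f t|).
Proof.
move=> mf; have [e ed] := separable_dense_seq sepV.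
(* Partial suprema of the functionals given by the normalised dense points. A zero point contributes
   0, the inverse of 0 being 0. *)
pose fix M (n : nat) (t : T) {struct n} : R := if n is k.+1 then
  Num.max (M k t) (`|e k|^-1 * ip (f t) (e k)) else 0.
have M0 n t : 0 <= M n t by elim: n => //= n IH; rewrite le_max IH.
have Mle n m t : (n <= m)%N -> M n t <= M m t.
  elim: m => [|m IH]; first by rewrite leqn0 => /eqP ->.
  by rewrite leq_eqVlt => /orP[/eqP -> //|/IH] /= h; rewrite le_max h.
have Mf n t : M n t <= `|f t|.
  elim: n => //= n IH; rewrite ge_max IH/=.
  have [->|en] := eqVneq `|e n| 0; first by rewrite invr0 mul0r.
  have en0 : 0 < `|e n| by rewrite lt_def en/=.
  by rewrite mulrC ler_pdivrMr// ip_le.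
apply: (@measurable_fun_cvg _ _ _ _ M).
  elim => [|n IH] //=; apply: measurable_maxr => //.
  exact: measurable_funM.
move=> t _; apply/cvgrPdist_le => eps0; move: (eps0 : R) => {eps0} eps eps0.
have eps20 : 0 < eps / 2 by rewrite divr_gt0.
have [k fk] := ed (f t) _ eps20.
exists k.+1 => // n /= kn; rewrite ger0_norm ?subr_ge0//.
rewrite lerBlDr -lerBlDl (le_trans _ (Mle _ _ t kn))//= le_max.
have fe : `|f t| <= `|e k| + eps / 2.
  by rewrite -(subrK (e k) (f t)) addrC (le_trans (ler_normD _ _))// lerD2l ltW.
(* If e_k is nonzero, then <f, e_k> / |e_k| >= |e_k| - eps/2 >= |f| - eps. If it is zero, |f| is
   itself at most eps/2 and [M0] suffices. *)
have [ek|ek] := eqVneq `|e k| 0; last first.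
  have ek0 : 0 < `|e k| by rewrite lt_def ek/=.
  apply/orP; right; rewrite ler_pdivlMl//.
  have -> : ip (f t) (e k) = `|e k| ^+ 2 + ip (f t - e k) (e k).
    by rewrite ipBl hilb addrCA subrr addr0.
  have := cauchy_schwarz hilb (f t - e k) (e k); rewrite ler_norml => /andP[+ _].
  have : `|f t - e k| * `|e k| <= eps / 2 * `|e k| by rewrite ler_wpM2r// ltW.
  have : `|e k| * `|f t| <= `|e k| * (`|e k| + eps / 2) by rewrite ler_wpM2l.
  rewrite mulrDr mulrBr -expr2 mulrC (mulrC `|e k| (eps / 2)) (mulrC eps).
  lra.
apply/orP; left; rewrite (le_trans _ (M0 k t))// subr_le0 (le_trans fe)//.
by rewrite ek add0r ler_pdivrMr// ler_peMr ?ltW// ltr1n.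
Qed.

End weakly_measurable.

(** * Real-valued integrals: sums, indicators and domination *)

Section Rintegral_complements.
Context d (T : measurableType d) (R : realType).
Variable mu : {measure set T -> \bar R}.

Lemma integrable_sumr I (r : seq I) (F : I -> T -> R) :
  (forall i, mu.-integrable setT (EFin \o F i)) ->
  mu.-integrable setT (EFin \o (fun t => \sum_(i <- r) F i t)).
Proof.
move=> iF; have := @integrable_sum _ _ _ mu setT measurableT _ r xpredT
  (fun i t => (F i t)%:E) (fun i _ => iF i).
by apply: eq_integrable => // t _ /=; rewrite sumEFin.
Qed.

Lemma Rintegral_sum I (r : seq I) (F : I -> T -> R) :
  (forall i, mu.-integrable setT (EFin \o F i)) ->
  \int[mu]_t (\sum_(i <- r) F i t) = \sum_(i <- r) \int[mu]_t F i t.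
Proof.
move=> iF; elim: r => [|i r IH].
  rewrite big_nil; under eq_Rintegral do rewrite big_nil.
  by rewrite Rintegral_cst// mul0r.
rewrite big_cons -IH -RintegralD//; last exact: integrable_sumr.
by apply: eq_Rintegral => t _; rewrite big_cons.
Qed.

Lemma Rintegral_indic A : measurable A -> \int[mu]_t \1_A t = fine (mu A).
Proof. by move=> mA; rewrite /Rintegral integral_indic// setIT. Qed.

Lemma integrable_le (f g : T -> R) : measurable_fun setT f ->
  mu.-integrable setT (EFin \o g) -> (forall t, `|f t| <= g t) ->
  mu.-integrable setT (EFin \o f).
Proof.
move=> mf ig fg; apply: le_integrable ig => //; first exact/measurable_EFinP.
by move=> t _ /=; rewrite lee_fin (le_trans (fg t))// ler_norm.
Qed.

Lemma integrable_add (f g : T -> R) : mu.-integrable setT (EFin \o f) ->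
  mu.-integrable setT (EFin \o g) ->
  mu.-integrable setT (EFin \o (fun t => f t + g t)).
Proof. by move=> fi gi; apply: eq_integrable (integrableD _ fi gi). Qed.

Lemma integrable_scale a (f : T -> R) : mu.-integrable setT (EFin \o f) ->
  mu.-integrable setT (EFin \o (fun t => a * f t)).
Proof. by move=> fi; apply: eq_integrable (integrableZl _ a fi). Qed.

End Rintegral_complements.

(** * Existence of the Bochner integral and its pairings *)

Section bochner_integral.
Context d (T : measurableType d) (R : realType) (V : completeNormedModType R).
Context (ip : {dot V for idfun}) (hilb : hilbert_norm ip) (sepV : separable V).
Variable mu : probability T R.

(** By Pettis, weak measurability is the right measurability in a separable space, so this is a
    checkable criterion for Bochner integrability. *)
Definition norm_integrable (f : T -> V) :=
  weakly_measurable ip f /\ mu.-integrable setT (EFin \o (fun t => `|f t|)).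

Lemma norm_integrable_le f (g : T -> R) : weakly_measurable ip f ->
  mu.-integrable setT (EFin \o g) -> (forall t, `|f t| <= g t) ->
  norm_integrable f.
Proof.
move=> mf ig fg; split => //; apply: integrable_le ig _.
  exact: weakly_measurable_norm.
by move=> t; rewrite normr_id.
Qed.

Lemma norm_integrableD f g : norm_integrable f -> norm_integrable g ->
  norm_integrable (fun t => f t + g t).
Proof.
move=> [mf fi] [mg gi].
apply: norm_integrable_le (weakly_measurableD mf mg) (integrable_add fi gi) _.
by move=> t; exact: ler_normD.
Qed.

Lemma norm_integrableZ a f : norm_integrable f ->
  norm_integrable (fun t => a *: f t).
Proof.
move=> [mf fi]; apply: norm_integrable_le (weakly_measurableZ a mf)
  (integrable_scale `|a| fi) _.
by move=> t; rewrite normrZ.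
Qed.

Lemma norm_integrableB f g : norm_integrable f -> norm_integrable g ->
  norm_integrable (fun t => f t - g t).
Proof.
move=> fi gi; have := norm_integrableD fi (norm_integrableZ (-1) gi).
by under [X in norm_integrable X]eq_fun do rewrite scaleN1r.
Qed.

Lemma norm_integrable_ip f v : norm_integrable f ->
  mu.-integrable setT (EFin \o (fun t => ip (f t) v)).
Proof.
move=> [mf fi]; apply: integrable_le (mf v) (integrable_scale `|v| fi) _.
by move=> t; rewrite mulrC cauchy_schwarz.
Qed.

Lemma Rintegral_ip_le f v : norm_integrable f ->
  `|\int[mu]_t ip (f t) v| <= `|v| * \int[mu]_t `|f t|.
Proof.
move=> fi; rewrite -RintegralZl//; last by case: fi.
have fv := norm_integrable_ip v fi.
apply: le_trans (le_normr_Rintegral measurableT fv) _.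
apply: le_Rintegral => //; first exact: integrable_norm.
  by apply: integrable_scale; case: fi.
by move=> t _; rewrite mulrC cauchy_schwarz.
Qed.

Section simple.
Variable s : T -> V.
Hypotheses (fs : finite_set (range s))
  (ms : forall v, measurable (s @^-1` [set v])).

Lemma simple_decomp (h : V -> R) t :
  h (s t) = \sum_(v <- fset_set (range s)) \1_(s @^-1` [set v]) t * h v.
Proof.
rewrite (big_fsetD1 (s t))/=; last by rewrite in_fset_set// inE; exists t.
rewrite indicE mem_set// mul1r big1_fset ?addr0// => v.
rewrite in_fsetD1 => /andP[vs _] _.
by rewrite indicE memNset ?mul0r//= => /esym/eqP; apply/negP.
Qed.

Lemma simple_norm_integrable : norm_integrable s.
Proof.
have mh (h : V -> R) : mu.-integrable setT (EFin \o (h \o s)).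
  have -> : h \o s =
      (fun t => \sum_(v <- fset_set (range s)) \1_(s @^-1` [set v]) t * h v).
    by apply/funext => t; rewrite -simple_decomp.
  apply: integrable_sumr => v.
  have := integrable_scale (h v) (integrable_indic mu (ms v)).
  by apply: eq_integrable => // t _ /=; rewrite mulrC.
split; last exact: (mh (fun v => `|v|)).
by move=> v; have /integrableP[/measurable_EFinP] := mh (ip^~ v).
Qed.

Lemma simple_integral_ip v :
  ip (simple_integral mu s) v = \int[mu]_t ip (s t) v.
Proof.
have iF (w : V) : mu.-integrable setT
    (EFin \o (fun t => \1_(s @^-1` [set w]) t * ip w v)).
  have := integrable_scale (ip w v) (integrable_indic mu (ms w)).
  by apply: eq_integrable => // t _ /=; rewrite mulrC.
transitivity (\int[mu]_t
    \sum_(w <- fset_set (range s)) (\1_(s @^-1` [set w]) t * ip w v)); last first.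
  by apply: eq_Rintegral => t _; rewrite -simple_decomp.
rewrite Rintegral_sum// /simple_integral fsbig_finite//= linear_sumlz.
apply: eq_bigr => w _; rewrite linearZl_LR/= RintegralZr//; last first.
  exact: integrable_indic.
by rewrite Rintegral_indic.
Qed.

End simple.

(** Pairing with [v] commutes with integrals of simple functions, and the approximation error is at
    most |v| times the integral of |f - s_n|. *)
Lemma bochner_integral_ip f x v : norm_integrable f -> is_bochner_integral mu f x ->
  ip x v = \int[mu]_t ip (f t) v.
Proof.
move=> fi [s [ms _ fs sx]].
have si n : norm_integrable (s n) by apply: simple_norm_integrable.
have c1 : ip (simple_integral mu (s n)) v @[n --> \oo] --> ip x v.
  exact: (cvg_comp _ _ sx (ip_continuous hilb (v := v) (x := x))).
have c2 : \int[mu]_t `|f t - s n t| @[n --> \oo] --> (0 : R).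
  exact: (fine_cvg fs).
apply/eqP; rewrite eq_sym -subr_eq0 -normr_le0.
have c3 : `|(\int[mu]_t ip (f t) v) - ip (simple_integral mu (s n)) v|
    @[n --> \oo] --> `|(\int[mu]_t ip (f t) v) - ip x v|.
  by apply: cvg_norm; apply: cvgB => //; exact: cvg_cst.
have c4 : `|v| * \int[mu]_t `|f t - s n t| @[n --> \oo] --> (0 : R).
  by rewrite -(mulr0 `|v|); apply: cvgM => //; exact: cvg_cst.
apply: (ler_cvg_to c3 c4); apply: nearW => n.
rewrite simple_integral_ip// -RintegralB//; [|exact: norm_integrable_ip..].
under eq_Rintegral do rewrite -ipBl.
by apply: Rintegral_ip_le; exact: norm_integrableB.
Qed.

Lemma norm_integrable_simple_approx f : norm_integrable f ->
  exists s : nat -> T -> V, [/\ forall n, finite_set (range (s n)),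
    forall n v, measurable (s n @^-1` [set v]),
    forall t, s n t @[n --> \oo] --> f t &
    (\int[mu]_t (`|f t - s n t|)%:E)%E @[n --> \oo] --> 0%E].
Proof.
move=> [wf fi]; have [e ed] := separable_dense_seq sepV.
have mf v : measurable_fun setT (fun t => `|f t - v|).
  apply: (weakly_measurable_norm hilb sepV); apply: weakly_measurableB => //.
have fe := nearest_cvg ed.
exists (fun n => nearest e f n); split => //.
- by move=> n; exact: nearest_finite.
- by move=> n v; exact: measurable_nearest.
rewrite -[X in _ --> X](integral0 mu setT).
apply: (@dominated_cvg _ _ _ mu setT measurableT
  (fun n t => (`|f t - nearest e f n t|)%:E) (cst 0%E)
  (fun t => (`|f t|)%:E)) => //.
- by move=> n; apply/measurable_EFinP; exact: measurable_nearest_dist.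
- move=> t _; apply: cvg_EFin; first exact: nearW.
  have h : `|f t - nearest e f n t| @[n --> \oo] --> `|f t - f t|.
    by apply: cvg_norm; apply: cvgB; [exact: cvg_cst|exact: fe].
  by rewrite subrr normr0 in h.
- by move=> n t _ /=; rewrite lee_fin normr_id nearest_dist_le.
Qed.

(** Testing with v = x gives |x|^2 <= |x| times the integral of |f|. *)
Lemma weak_mean_norm_le f x : norm_integrable f ->
  (forall v, ip x v = \int[mu]_t ip (f t) v) -> `|x| <= \int[mu]_t `|f t|.
Proof.
move=> fi xf; have [->|x0] := eqVneq x 0.
  by rewrite normr0 Rintegral_ge0.
have nx : 0 < `|x| by rewrite normr_gt0.
rewrite -(ler_pM2l nx) -expr2 -hilb xf.
exact: le_trans (ler_norm _) (Rintegral_ip_le x fi).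
Qed.

Lemma bochner_integral_exists f : norm_integrable f ->
  exists x, is_bochner_integral mu f x.
Proof.
move=> fi; have [s [fs ms sf scvg]] := norm_integrable_simple_approx fi.
have si n : norm_integrable (s n) by apply: simple_norm_integrable.
pose D n := \int[mu]_t `|f t - s n t|.
have Dcvg : D n @[n --> \oo] --> (0 : R) by exact: (fine_cvg scvg).
pose I n := simple_integral mu (s n).
(* [I n - I m] is the weak mean of [s n - s m], so [weak_mean_norm_le] and the triangle inequality
   through [f] make the simple integrals a Cauchy sequence. *)
have ID n m : `|I n - I m| <= D n + D m.
  have h : `|I n - I m| <= \int[mu]_t `|s n t - s m t|.
    apply: weak_mean_norm_le; first exact: norm_integrableB.
    move=> v; rewrite ipBl !simple_integral_ip// -RintegralB//;
      [|exact: norm_integrable_ip..].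
    by under eq_Rintegral do rewrite -ipBl.
  have fsi k : mu.-integrable setT (EFin \o (fun t => `|f t - s k t|)).
    by have [] := norm_integrableB fi (si k).
  rewrite (le_trans h)// -RintegralD//; apply: le_Rintegral => //.
  - by have [] := norm_integrableB (si n) (si m).
  - exact: integrable_add.
  move=> t _; rewrite (distrC (f t)).
  rewrite (_ : s n t - s m t = s n t - f t + (f t - s m t)) ?ler_normD//.
  by rewrite addrA subrK.
have Icvg : cvg (I n @[n --> \oo]).
  apply: cauchy_cvg; apply: cauchy_exP => eps' eps0.
  move: (eps' : R) eps0 => eps eps0.
  have e2 : 0 < eps / 2 by rewrite divr_gt0.
  have /cvgrPdist_lt/(_ _ e2)[N _ HN] := Dcvg.
  have {}HN n : (N <= n)%N -> D n < eps / 2.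
    by move=> /HN; rewrite sub0r normrN; apply: le_lt_trans; exact: ler_norm.
  exists (I N); exists N => // n /= Nn; rewrite -ball_normE /ball_/=.
  rewrite (le_lt_trans (ID _ _))// [ltRHS]splitr ltrD// HN//.
exists (lim (I n @[n --> \oo])).
pose sF n : {fimfun T >-> V} := HB.pack (s n) (FiniteImage.Build T V (s n) (fs n)).
exists sF; split => //.
exact: aeW.
Qed.

(** Existence rules out the default value in [bochner], and whichever integral [xget] selects has
    these pairings. *)
Theorem bochner_ip f v : norm_integrable f ->
  ip (bochner mu f) v = \int[mu]_t ip (f t) v.
Proof.
move=> fi; apply: bochner_integral_ip => //; rewrite /bochner.
by case: xgetP => [x _ //|nx]; have [x /nx] := bochner_integral_exists fi.
Qed.

End bochner_integral.

(** * Functions of finitely many independent samples *)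

Section independence.
Context d (T : measurableType d) d' (S : measurableType d') (R : realType).
Context (P : probability T R) (mu : probability S R) (z : nat -> {mfun T >-> S}).

(** Rectangles in the samples of index below [m], one factor per index; the full set is an allowed
    factor, so levels are nested. *)
Inductive cylinder : nat -> set T -> Prop :=
| cylinder0 : cylinder 0 setT
| cylinderS m A B : cylinder m A -> measurable B ->
    cylinder m.+1 (z m @^-1` B `&` A).

Lemma measurable_preim m B : measurable B -> measurable (z m @^-1` B).
Proof. by move=> mB; rewrite -[X in measurable X]setTI; exact: measurable_funPT. Qed.

Lemma measurable_cylinder m A : cylinder m A -> measurable A.
Proof.
elim => // k {}A B _ mA mB; apply: measurableI => //.
exact: measurable_preim.
Qed.

Lemma cylinder_succ m A : cylinder m A -> cylinder m.+1 A.
Proof.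
by move=> cA; have := cylinderS cA measurableT; rewrite preimage_setT setTI.
Qed.

Fixpoint initial m : {fset nat} :=
  if m is k.+1 then (k |` initial k)%fset else fset0.

Lemma in_initial m i : (i \in initial m) = (i < m)%N.
Proof.
elim: m => [|m IH]; first by rewrite in_fset0.
by rewrite in_fset1U IH ltnS [RHS]leq_eqVlt.
Qed.

(** Brings a cylinder into the finite-intersection form in which mutual independence is stated. *)
Lemma cylinderP m A : cylinder m A -> exists2 B : nat -> set S,
  (forall i, measurable (B i)) & A = \bigcap_(i in [set` initial m]) (z i @^-1` B i).
Proof.
elim => [|k {}A B _ [B' mB' ->] mB].
  by exists (fun=> setT) => //=; rewrite set_fset0 bigcap_set0.
exists (fun i => if i == k then B else B' i) => [i|]; first by case: eqP.
rewrite /= set_fsetU1 bigcap_setU1 eqxx; congr (_ `&` _).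
apply: eq_bigcapr => i /=; rewrite in_initial => ik.
by rewrite ltn_eqF.
Qed.

Hypothesis ziid : iid P mu z.

Lemma iid_preim m B : measurable B -> P (z m @^-1` B) = mu B.
Proof. by move=> mB; rewrite -(ziid.2 m B mB). Qed.

(** Mutual independence is applied twice, to the indices up to [m] and to those below [m]; the two
    products differ by the factor of index [m]. *)
Lemma cylinder_indep m A B : cylinder m A -> measurable B ->
  P (z m @^-1` B `&` A) = (mu B * P A)%E.
Proof.
move=> cA mB; have [B' mB' EA] := cylinderP cA.
pose B'' i := if i == m then B else B' i.
have mB'' i : measurable (B'' i) by rewrite /B''; case: eqP.
have E : A = \bigcap_(i in [set` initial m]) (z i @^-1` B'' i).
  rewrite EA; apply: eq_bigcapr => i /=; rewrite in_initial => im.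
  by rewrite /B'' ltn_eqF.
have := ziid.1 (initial m.+1) B'' mB''.
rewrite /= set_fsetU1 bigcap_setU1 -E.
rewrite big_fsetU1 ?in_initial ?ltnn//= {1 2}/B'' eqxx => ->.
by rewrite -(ziid.1 (initial m) B'' mB'') -E iid_preim.
Qed.

(** By [cylinder_indep], the image under [z m] of [P] restricted to [A] is the measure [mu] scaled
    by [P A]; the rest is a change of variables. *)
Lemma ge0_integral_cylinder m A (f : S -> \bar R) : cylinder m A ->
  measurable_fun setT f -> (forall s, 0 <= f s)%E ->
  (\int[P]_(t in A) f (z m t) = P A * \int[mu]_s f s)%E.
Proof.
move=> cA mf f0; have mA := measurable_cylinder cA.
have mfz : measurable_fun setT (f \o z m) by exact: measurableT_comp.
have PA : 0 <= fine (P A) by exact: fine_ge0.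
have -> : P A = ((NngNum PA)%:num%:E)%E by rewrite /= fineK// fin_num_measure.
rewrite -ge0_integral_mscale//.
transitivity (\int[mrestr P mA]_(t in A) (f \o z m) t)%E.
  apply: eq_measure_integral => B mB BA.
  by rewrite /= /mrestr setIidl.
transitivity (\int[mrestr P mA]_t (f \o z m) t)%E.
  rewrite [RHS](@ge0_negligible_integral _ _ _ _ _ (~` A))//.
  - by rewrite setTD setCK.
  - exact: measurableC.
  - by move=> t _; exact: f0.
  - by rewrite /= /mrestr setICl measure0.
transitivity (\int[pushforward (mrestr P mA) (z m)]_s f s)%E.
  by rewrite ge0_integral_pushforward.
apply: eq_measure_integral => B mB _.
rewrite /= /pushforward /mrestr /mscale/= cylinder_indep// muleC.
by rewrite fineK// fin_num_measure.
Qed.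

Lemma integrable_comp_sample m (f : S -> R) : mu.-integrable setT (EFin \o f) ->
  P.-integrable setT (EFin \o (f \o z m)).
Proof.
move=> /integrableP[mf fi]; apply/integrableP; split.
  exact: (measurableT_comp mf).
have cT : cylinder m setT.
  elim: m => [|m IH]; [exact: cylinder0|exact: cylinder_succ].
rewrite (ge0_integral_cylinder cT (f := fun s => `|(f s)%:E|%E))//.
  by rewrite probability_setT mul1e.
exact: measurableT_comp.
Qed.

(** The signed case follows from positive and negative parts, integrability making their difference
    well defined. *)
Lemma Rintegral_cylinder m A (f : S -> R) : cylinder m A ->
  mu.-integrable setT (EFin \o f) ->
  \int[P]_t (\1_A t * f (z m t)) = fine (P A) * \int[mu]_s f s.
Proof.
move=> cA fi; have mA := measurable_cylinder cA.
transitivity (\int[P]_(t in A) f (z m t)).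
  rewrite [RHS]Rintegral_mkcond; apply: eq_Rintegral => t _.
  by rewrite patchE indicE; case: ifP; rewrite ?mul1r ?mul0r.
have mf : measurable_fun setT (EFin \o f) by case/integrableP: fi.
rewrite /Rintegral -fineM ?fin_num_measure//; last exact: integrable_fin_num.
congr fine; rewrite integralE [in RHS]integralE muleBr ?fin_num_measure//.
  congr (_ - _)%E.
  - rewrite -(ge0_integral_cylinder cA (f := (EFin \o f)^\+%E))//.
      by apply: eq_integral => t _; rewrite !funeposE.
    exact: measurable_funepos.
  - rewrite -(ge0_integral_cylinder cA (f := (EFin \o f)^\-%E))//.
      by apply: eq_integral => t _; rewrite !funenegE.
    exact: measurable_funeneg.
exact: integrable_add_def.
Qed.

End independence.

(** * Vector-valued functions of the first samples *)

Section adapted.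
Context d (T : measurableType d) d' (S : measurableType d') (R : realType).
Context (V : completeNormedModType R) (ip : {dot V for idfun}).
Hypotheses (hilb : hilbert_norm ip) (sepV : separable V).
Context (P : probability T R) (mu : probability S R) (z : nat -> {mfun T >-> S}).
Hypothesis ziid : iid P mu z.

Let L1 := norm_integrable ip P.

(** The cylinders in the sum may overlap, which makes closure under addition immediate. *)
Inductive cylinder_step (m : nat) : (T -> V) -> Prop :=
| cylinder_step0 : cylinder_step m (cst 0)
| cylinder_stepS A c f : cylinder z m A -> cylinder_step m f ->
    cylinder_step m (fun t => \1_A t *: c + f t).

Lemma norm_integrable_indic A f : measurable A -> L1 f ->
  L1 (fun t => \1_A t *: f t).
Proof.
move=> mA [mf fi]; apply: (norm_integrable_le hilb sepV _ fi).
  move=> v; under eq_fun do rewrite ipZl.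
  exact: measurable_funM.
move=> t; rewrite normrZ ger0_norm// indicE.
by case: (_ \in _); rewrite ?mul1r ?mul0r.
Qed.

Lemma norm_integrable_cst c : L1 (cst c).
Proof.
split; first exact: (weakly_measurable_cst ip c).
exact: (finite_measure_integrable_cst P `|c| measurableT).
Qed.

Lemma cylinder_step_norm_integrable m f : cylinder_step m f -> L1 f.
Proof.
elim=> [|A c {}f cA _ fi]; first exact: norm_integrable_cst.
apply: norm_integrableD => //; apply: norm_integrable_indic.
  exact: measurable_cylinder cA.
exact: norm_integrable_cst.
Qed.

Lemma cylinder_stepD m f g : cylinder_step m f -> cylinder_step m g ->
  cylinder_step m (fun t => f t + g t).
Proof.
move=> sf sg; elim: sf => [|A c {}f cA _ IH].
  by under eq_fun do rewrite add0r.
by under eq_fun do rewrite -addrA; exact: cylinder_stepS.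
Qed.

Lemma cylinder_stepZ m a f : cylinder_step m f ->
  cylinder_step m (fun t => a *: f t).
Proof.
elim=> [|A c {}f cA _ IH].
  by under eq_fun do rewrite scaler0; exact: cylinder_step0.
under eq_fun do rewrite scalerDr scalerA mulrC -scalerA.
exact: cylinder_stepS.
Qed.

Lemma cylinder_step_succ m f : cylinder_step m f -> cylinder_step m.+1 f.
Proof.
elim=> [|A c {}f cA _ IH]; first exact: cylinder_step0.
by apply: cylinder_stepS => //; exact: cylinder_succ.
Qed.

(* [L^1]-limits of step functions over cylinders: a stand-in for measurability
   with respect to the sigma-algebra of the first [m] samples. *)
Definition adapted m f := L1 f /\ forall eps : R, 0 < eps ->
  exists2 g, cylinder_step m g & \int[P]_t `|f t - g t| <= eps.

Lemma Rintegral_norm_triangle f g h : L1 f -> L1 g -> L1 h ->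
  \int[P]_t `|f t - h t| <=
  \int[P]_t `|f t - g t| + \int[P]_t `|g t - h t|.
Proof.
move=> fi gi hi.
have fg := (norm_integrableB hilb sepV fi gi).2.
have gh := (norm_integrableB hilb sepV gi hi).2.
have fh := (norm_integrableB hilb sepV fi hi).2.
rewrite -RintegralD//; apply: le_Rintegral => //; first exact: integrable_add.
by move=> t _; exact: ler_distD.
Qed.

Lemma adapted_limit m f : L1 f -> (forall eps : R, 0 < eps ->
  exists2 g, adapted m g & \int[P]_t `|f t - g t| <= eps) -> adapted m f.
Proof.
move=> fi flim; split => // eps eps0.
have e2 : 0 < eps / 2 by rewrite divr_gt0.
have [g [gi /(_ _ e2)[h hs gh]] fg] := flim _ e2.
exists h => //; rewrite [leRHS]splitr.
apply: le_trans (Rintegral_norm_triangle fi gi _) _; last exact: lerD.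
exact: cylinder_step_norm_integrable hs.
Qed.

Lemma adapted_step m f : cylinder_step m f -> adapted m f.
Proof.
move=> sf; split; first exact: cylinder_step_norm_integrable sf.
move=> eps eps0; exists f => //.
under eq_Rintegral do rewrite subrr normr0.
by rewrite Rintegral_cst// mul0r ltW.
Qed.

Lemma adapted_succ m f : adapted m f -> adapted m.+1 f.
Proof.
move=> [fi fa]; split => // eps /fa[g gs fg]; exists g => //.
exact: cylinder_step_succ.
Qed.

Lemma adaptedD m f g : adapted m f -> adapted m g ->
  adapted m (fun t => f t + g t).
Proof.
move=> [fi fa] [gi ga]; split; first exact: norm_integrableD.
move=> eps eps0; have e2 : 0 < eps / 2 by rewrite divr_gt0.
have [f' fs ff'] := fa _ e2; have [g' gs gg'] := ga _ e2.
exists (fun t => f' t + g' t); first exact: cylinder_stepD.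
have f'i := cylinder_step_norm_integrable fs.
have g'i := cylinder_step_norm_integrable gs.
have fg := (norm_integrableB hilb sepV fi f'i).2.
have gh := (norm_integrableB hilb sepV gi g'i).2.
rewrite [leRHS]splitr (le_trans _ (lerD ff' gg'))// -RintegralD//.
apply: le_Rintegral => //.
- by have [] := norm_integrableB hilb sepV (norm_integrableD hilb sepV fi gi)
    (norm_integrableD hilb sepV f'i g'i).
- exact: integrable_add.
by move=> t _; rewrite opprD addrACA ler_normD.
Qed.

Lemma adaptedZ m a f : adapted m f -> adapted m (fun t => a *: f t).
Proof.
move=> [fi fa]; split; first exact: norm_integrableZ.
move=> eps eps0; have a1 : 0 < `|a| + 1 by rewrite ltr_wpDl.
have [g gs fg] := fa _ (divr_gt0 eps0 a1).
exists (fun t => a *: g t); first exact: cylinder_stepZ.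
under eq_Rintegral do rewrite -scalerBr normrZ.
have [_ fgi] := norm_integrableB hilb sepV fi (cylinder_step_norm_integrable gs).
rewrite RintegralZl// (@le_trans _ _ (`|a| * (eps / (`|a| + 1))))//.
  exact: ler_wpM2l.
by rewrite mulrCA ger_pMr// ler_pdivrMr// mul1r lerDl.
Qed.

Lemma norm_integrable_comp_sample m (phi : S -> V) : norm_integrable ip mu phi ->
  L1 (phi \o z m).
Proof.
move=> [mphi iphi]; split; last exact: (integrable_comp_sample ziid m iphi).
by move=> v; apply: (measurableT_comp (mphi v)).
Qed.

(** For a simple function of the sample, each fibre meets [A] in a cylinder of level [m.+1]. The
    general case is an L^1 limit, the error being transported from [mu] to [P] by the law of
    [z m]. *)
Lemma adapted_comp_sample m A (phi : S -> V) : cylinder z m A ->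
  norm_integrable ip mu phi -> adapted m.+1 (fun t => \1_A t *: phi (z m t)).
Proof.
move=> cA iphi; have mA := measurable_cylinder cA.
apply: adapted_limit.
  by apply: norm_integrable_indic => //; exact: norm_integrable_comp_sample.
move=> eps eps0.
have [s [fs ms _ sphi]] := norm_integrable_simple_approx hilb sepV iphi.
have Dcvg : \int[mu]_x `|phi x - s n x| @[n --> \oo] --> (0 : R).
  exact: (fine_cvg sphi).
have /cvgrPdist_lt/(_ _ eps0)[N _ /(_ N (leqnn _))] := Dcvg.
rewrite sub0r normrN => sN.
have si : norm_integrable ip mu (s N) by apply: simple_norm_integrable.
exists (fun t => \1_A t *: s N (z m t)).
  apply: adapted_step.
  have -> : (fun t => \1_A t *: s N (z m t)) = (fun t =>
      \sum_(v <- fset_set (range (s N)))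
        \1_(z m @^-1` (s N @^-1` [set v]) `&` A) t *: v).
    apply/funext => t.
    rewrite (big_fsetD1 (s N (z m t)))/=; last first.
      by rewrite in_fset_set// inE; exists (z m t).
    rewrite big1_fset ?addr0.
      by rewrite !indicE in_setI (_ : (t \in z m @^-1` _) = true)//; exact: mem_set.
    move=> v; rewrite in_fsetD1 => /andP[vs _] _.
    rewrite indicE memNset ?scale0r// => -[/esym/eqP + _].
    exact/negP.
  elim: (enum_fset _) => [|v r IH].
    by under eq_fun do rewrite big_nil; exact: cylinder_step0.
  under eq_fun do rewrite big_cons.
  by apply: cylinder_stepS => //; exact: cylinderS.
have [_ psi] := norm_integrableB hilb sepV iphi si.
have c0 : cylinder z m setT.
  elim: (m) => [|k IH]; [exact: cylinder0|exact: cylinder_succ].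
rewrite (le_trans _ (le_trans (ler_norm _) (ltW sN)))//.
have -> : \int[mu]_x `|phi x - s N x| = \int[P]_t `|phi (z m t) - s N (z m t)|.
  have := Rintegral_cylinder ziid c0 psi.
  rewrite probability_setT mul1r => <-.
  by apply: eq_Rintegral => t _; rewrite indicE in_setT mul1r.
apply: le_Rintegral => //.
- by have [] := norm_integrableB hilb sepV
    (norm_integrable_indic mA (norm_integrable_comp_sample m iphi))
    (norm_integrable_indic mA (norm_integrable_comp_sample m si)).
- exact: (integrable_comp_sample ziid m psi).
move=> t _; rewrite -scalerBr normrZ ger0_norm// indicE.
by case: (_ \in _); rewrite ?mul1r ?mul0r.
Qed.

(** * Random operators applied to earlier samples *)

Section random_operator.
Variables (K : S -> {linear V -> V}) (L : R).
Hypothesis K_bounded : forall s v, `|K s v| <= L * `|v|.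
Hypothesis K_meas : forall v, weakly_measurable ip (K^~ v).

Lemma ip_operator_continuous s v : continuous (fun u => ip (K s u) v).
Proof.
move=> u; apply/cvgrPdist_lt => eps' eps0; move: (eps' : R) eps0 => eps eps0.
have c0 : 0 < `|L| * `|v| + 1 by rewrite ltr_wpDl// mulr_ge0.
have d0 := divr_gt0 eps0 c0.
near=> w.
have uw : `|u - w| < eps / (`|L| * `|v| + 1) by near: w; exact: cvgr_dist_lt.
rewrite -ipBl -raddfB (le_lt_trans (cauchy_schwarz hilb _ _))//.
rewrite (@le_lt_trans _ _ (`|u - w| * (`|L| * `|v| + 1)))//.
  have h : `|K s (u - w)| <= `|L| * `|u - w|.
    by rewrite (le_trans (K_bounded _ _))// ler_wpM2r// ler_norm.
  rewrite (le_trans (ler_wpM2r _ h))// mulrDr mulr1.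
  by rewrite (mulrC `|L|) -mulrA lerDl.
by rewrite -ltr_pdivlMr.
Unshelve. all: by end_near. Qed.

Lemma norm_integrable_operator m f : L1 f -> L1 (fun t => K (z m t) (f t)).
Proof.
move=> [mf fi].
apply: (norm_integrable_le hilb sepV _ (integrable_scale L fi)) => // v.
apply: (measurable_caratheodory (h := fun t u => ip (K (z m t) u) v) sepV) => //.
- move=> c; apply: weakly_measurable_norm => //.
  by apply: weakly_measurableB => //; exact: (weakly_measurable_cst ip c).
- by move=> c; apply: (measurableT_comp (K_meas c v)).
- by move=> t; exact: ip_operator_continuous.
Qed.

Lemma norm_integrable_operator_cst c : norm_integrable ip mu (K^~ c).
Proof.
apply: (norm_integrable_le hilb sepV (g := fun=> L * `|c|)) => //.
exact: (finite_measure_integrable_cst mu (L * `|c|) measurableT).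
Qed.

Lemma adapted_operator_step m f : cylinder_step m f ->
  adapted m.+1 (fun t => K (z m t) (f t)).
Proof.
elim=> [|A c {}f cA _ IH].
  by under eq_fun do rewrite raddf0; apply: adapted_step; exact: cylinder_step0.
under eq_fun do rewrite raddfD/= linearZ/=.
apply: adaptedD => //; apply: (adapted_comp_sample (phi := K^~ c)) => //.
exact: norm_integrable_operator_cst.
Qed.

(** The uniform bound on [K] makes its application Lipschitz in L^1, so the claim passes from step
    functions to their limits. *)
Lemma adapted_operator m f : adapted m f ->
  adapted m.+1 (fun t => K (z m t) (f t)).
Proof.
move=> [fi fa]; apply: adapted_limit; first exact: norm_integrable_operator.
move=> eps eps0; have a1 : 0 < `|L| + 1 by rewrite ltr_wpDl.
have [g gs fg] := fa _ (divr_gt0 eps0 a1).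
exists (fun t => K (z m t) (g t)); first exact: adapted_operator_step.
have gi := cylinder_step_norm_integrable gs.
have [_ fgi] := norm_integrableB hilb sepV fi gi.
rewrite (@le_trans _ _ (\int[P]_t (`|L| * `|f t - g t|)))//.
  apply: le_Rintegral => //.
  - by have [] := norm_integrableB hilb sepV (norm_integrable_operator m fi)
      (norm_integrable_operator m gi).
  - exact: integrable_scale.
  move=> t _; rewrite -raddfB (le_trans (K_bounded _ _))//.
  by rewrite ler_wpM2r// ler_norm.
rewrite RintegralZl// (@le_trans _ _ (`|L| * (eps / (`|L| + 1))))//.
  exact: ler_wpM2l.
by rewrite mulrCA ger_pMr// ler_pdivrMr// mul1r lerDl.
Qed.

Section mean_operator.
Variable Q : {linear V -> V}.
Hypothesis Q_mean : forall v w, ip (Q v) w = \int[mu]_s ip (K s v) w.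
Hypothesis Q_sym : forall v w, ip (Q v) w = ip v (Q w).

(** On a term with value [c] over a cylinder [A], independence factors the left side into P(A) <Q c,
    v>, and symmetry moves [Q] onto [v]. *)
Lemma mean_operator_step m f v : cylinder_step m f ->
  \int[P]_t ip (K (z m t) (f t)) v = \int[P]_t ip (f t) (Q v).
Proof.
elim=> [|A c {}f cA sf IH].
  by apply: eq_Rintegral => t _; rewrite raddf0 !ip0l.
have fi := cylinder_step_norm_integrable sf.
have mA := measurable_cylinder cA.
have iK := norm_integrable_operator_cst c.
have i1 := norm_integrable_ip hilb v (norm_integrable_indic mA
  (norm_integrable_comp_sample m iK)).
have i2 := norm_integrable_ip hilb (Q v) (norm_integrable_indic mA
  (norm_integrable_cst c)).
have i3 := norm_integrable_ip hilb (Q v) fi.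
have i4 := norm_integrable_ip hilb v (norm_integrable_operator m fi).
under eq_Rintegral do rewrite raddfD/= linearZ/= ipDl.
under [RHS]eq_Rintegral do rewrite ipDl.
rewrite !RintegralD// IH; congr (_ + _).
under eq_Rintegral do rewrite ipZl.
under [RHS]eq_Rintegral do rewrite ipZl.
rewrite (Rintegral_cylinder ziid cA (f := fun s => ip (K s c) v)); last first.
  exact: norm_integrable_ip.
by rewrite -Q_mean Q_sym RintegralZr ?Rintegral_indic//; exact: integrable_indic.
Qed.

Lemma mean_operator_adapted m f v : adapted m f ->
  \int[P]_t ip (K (z m t) (f t)) v = \int[P]_t ip (f t) (Q v).
Proof.
move=> [fi fa]; apply/eqP; rewrite -subr_eq0 -normr_le0.
apply/ler_addgt0Pl => eps eps0; rewrite addr0.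
(* Replacing [f] by a step function changes the left side by at most |L| |v| and the right side by
   at most |Q v|, each times the L^1 error. *)
have c0 : 0 < `|L| * `|v| + `|Q v| + 1.
  by rewrite ltr_wpDl// addr_ge0// mulr_ge0.
have [g gs fg] := fa _ (divr_gt0 eps0 c0).
have gi := cylinder_step_norm_integrable gs.
have fgi := norm_integrableB hilb sepV fi gi.
have Kf := norm_integrable_operator m fi.
have Kg := norm_integrable_operator m gi.
have Kfg := norm_integrableB hilb sepV Kf Kg.
have h1 := Rintegral_ip_le hilb v Kfg.
have h2 := Rintegral_ip_le hilb (Q v) fgi.
have h3 : \int[P]_t `|K (z m t) (f t) - K (z m t) (g t)| <=
    `|L| * \int[P]_t `|f t - g t|.
  rewrite -RintegralZl//; last by case: fgi.
  apply: le_Rintegral => //; first by case: Kfg.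
    by apply: integrable_scale; case: fgi.
  move=> t _; rewrite -raddfB (le_trans (K_bounded _ _))//.
  by rewrite ler_wpM2r// ler_norm.
have E1 : \int[P]_t ip (K (z m t) (f t) - K (z m t) (g t)) v =
   \int[P]_t ip (K (z m t) (f t)) v - \int[P]_t ip (K (z m t) (g t)) v.
  by rewrite -RintegralB//; [under eq_Rintegral do rewrite ipBl|
    exact: norm_integrable_ip..].
have E2 : \int[P]_t ip (f t - g t) (Q v) =
   \int[P]_t ip (f t) (Q v) - \int[P]_t ip (g t) (Q v).
  by rewrite -RintegralB//; [under eq_Rintegral do rewrite ipBl|
    exact: norm_integrable_ip..].
have E := mean_operator_step v gs.
rewrite (_ : _ - _ = \int[P]_t ip (K (z m t) (f t) - K (z m t) (g t)) v -
  \int[P]_t ip (f t - g t) (Q v)); last by rewrite E1 E2 E; ring.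
rewrite (le_trans (ler_normB _ _))// (le_trans (lerD h1 h2))//.
have {}h3 := ler_wpM2l (normr_ge0 v) h3.
rewrite (le_trans (lerD h3 (lexx _)))//.
rewrite mulrA -mulrDl (mulrC `|v|).
rewrite (@le_trans _ _ ((`|L| * `|v| + `|Q v|) *
  (eps / (`|L| * `|v| + `|Q v| + 1))))//.
  by rewrite ler_wpM2l// addr_ge0// mulr_ge0.
by rewrite mulrCA ger_pMr// ler_pdivrMr// mul1r lerDl.
Qed.

End mean_operator.
End random_operator.
End adapted.

(** * The recursion for the means *)

Section stochastic_iteration.
Context d (T : measurableType d) d' (S : measurableType d') (R : realType).
Context (V : completeNormedModType R) (ip : {dot V for idfun}).
Hypotheses (hilb : hilbert_norm ip) (sepV : separable V).
Context (P : probability T R) (mu : probability S R) (z : nat -> {mfun T >-> S}).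
Hypothesis ziid : iid P mu z.
Variables (K : S -> {linear V -> V}) (L : R).
Hypothesis K_bounded : forall s v, `|K s v| <= L * `|v|.
Hypothesis K_meas : forall v, weakly_measurable ip (K^~ v).
Variable Q : {linear V -> V}.
Hypothesis Q_mean : forall v w, ip (Q v) w = \int[mu]_s ip (K s v) w.
Hypothesis Q_sym : forall v w, ip (Q v) w = ip v (Q w).
Variable psi : S -> V.
Hypothesis psi_int : norm_integrable ip mu psi.
Variables (a b : nat -> R) (u : nat -> T -> V).
Hypothesis u_cst : exists c, u 0 = cst c.
Hypothesis uS : forall m t,
  u m.+1 t = a m *: (u m t + b m *: (psi (z m t) - K (z m t) (u m t))).

Lemma cylinderT m : cylinder z m setT.
Proof. by elim: m => [|m IH]; [exact: cylinder0|exact: cylinder_succ]. Qed.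

Lemma adapted_sample m : adapted ip P z m.+1 (psi \o z m).
Proof.
have := adapted_comp_sample hilb sepV ziid (cylinderT m) psi_int.
by under eq_fun do rewrite indicE in_setT scale1r.
Qed.

(** The precise form of the claim that the iterate depends on the first [m] samples only, hence can
    be treated as independent of [z m]. *)
Lemma adapted_iterates m : adapted ip P z m (u m).
Proof.
elim: m => [|m IH].
  have [c ->] := u_cst; apply: adapted_step => //.
  have -> : cst c = (fun t : T => \1_[set: T] t *: c + 0 : V).
    by apply/funext => t; rewrite indicE in_setT scale1r addr0.
  by apply: cylinder_stepS; [exact: cylinder0|exact: cylinder_step0].
rewrite (funext (uS m)); apply: adaptedZ => //; apply: adaptedD => //.
  exact: adapted_succ.
apply: adaptedZ => //; apply: adaptedD => //; first exact: adapted_sample.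
under eq_fun do rewrite -scaleN1r; apply: adaptedZ => //.
exact: (adapted_operator hilb sepV ziid K_bounded K_meas IH).
Qed.

(** After pairing with [v], only the term with [K] couples the iterate to the new sample, and
    [mean_operator_adapted] replaces it by its mean. *)
Lemma bochner_iterates m : bochner P (u m.+1) =
  a m *: (bochner P (u m) + b m *: (bochner mu psi - Q (bochner P (u m)))).
Proof.
have [ui _] := adapted_iterates m; have [uSi _] := adapted_iterates m.+1.
have zi := norm_integrable_comp_sample ziid m psi_int.
have Ki := norm_integrable_operator hilb sepV z K_bounded K_meas m ui.
have psiE v : \int[P]_t ip (psi (z m t)) v = \int[mu]_s ip (psi s) v.
  have := Rintegral_cylinder ziid (cylinderT m) (norm_integrable_ip hilb v psi_int).
  rewrite probability_setT mul1r => <-.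
  by apply: eq_Rintegral => t _; rewrite indicE in_setT mul1r.
apply: (ip_ext hilb) => v.
rewrite (bochner_ip hilb sepV v uSi).
rewrite ipZl ipDl ipZl ipBl Q_sym !(bochner_ip hilb sepV)//.
rewrite -(mean_operator_adapted hilb sepV ziid K_bounded K_meas Q_mean Q_sym v
  (adapted_iterates m)) -psiE.
have i1 := norm_integrable_ip hilb v ui.
have i2 := norm_integrable_ip hilb v zi.
have i3 := norm_integrable_ip hilb v Ki.
have i23 := integrable_add i2 (integrable_scale (-1) i3).
have E t : ip (u m.+1 t) v = a m * (ip (u m t) v + b m * (ip (psi (z m t)) v
    + (-1) * ip (K (z m t) (u m t)) v)).
  by rewrite uS ipZl ipDl ipZl ipBl mulN1r.
under eq_Rintegral do rewrite E.
rewrite RintegralZl//; last by apply: integrable_add => //; exact: integrable_scale.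
rewrite RintegralD//; last exact: integrable_scale.
rewrite RintegralZl// RintegralD//; last exact: integrable_scale.
by rewrite RintegralZl// mulN1r.
Qed.

End stochastic_iteration.

(** * Measurability over generated sigma-algebras *)

Lemma preimage_open_measurable (R : realType) (U : pointedType)
    (G : set (set U)) (f : U -> R) : (forall A, open A -> G (f @^-1` A)) ->
  measurable_fun [set: g_sigma_algebraType G] (f : g_sigma_algebraType G -> R).
Proof.
move=> fG; apply: (measurability _ (RGenOpens.measurableE R)).
move=> _ [_ [x [y ->] <-]]; rewrite setTI; apply: sub_sigma_algebra.
by apply: fG; exact: interval_open.
Qed.

Lemma preimage_generator_measurable (U W : pointedType) (G : set (set U))
    (H : set (set W)) (f : U -> W) : (forall A, H A -> G (f @^-1` A)) ->
  measurable_fun [set: g_sigma_algebraType G]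
    (f : g_sigma_algebraType G -> g_sigma_algebraType H).
Proof.
move=> fG; apply: (@measurability _ _ (g_sigma_algebraType G)
  (g_sigma_algebraType H) setT f H erefl).
by move=> _ [A oA <-]; rewrite setTI; apply: sub_sigma_algebra; exact: fG.
Qed.

(** * Operator norms of continuous linear maps *)

Section operator_norm.
Context (R : realType) (Y V : normedModType R) (B : {linear Y -> V}).
Hypothesis Bc : continuous B.

Let opnorm_set := [set `|B y| | y in [set y | `|y| <= 1]].

(** Ensures that the [sup] in [opnorm] is a true supremum and not a default value. *)
Lemma opnorm_has_ubound : has_ubound opnorm_set.
Proof.
have /linear_bounded_continuous/linear_boundedP[M [_ HM]] := Bc.
exists (`|M| + 1) => _ [y /= y1 <-].
have := HM (`|M| + 1); rewrite (le_lt_trans (ler_norm M)) ?ltrDl// => /(_ erefl y).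
by move=> /le_trans; apply; rewrite ler_piMr// addr_ge0.
Qed.

Lemma opnorm_ge0 : 0 <= opnorm B.
Proof.
apply: ub_le_sup; first exact: opnorm_has_ubound.
by exists 0; rewrite /= ?raddf0 ?normr0.
Qed.

Lemma opnorm_le y : `|B y| <= opnorm B * `|y|.
Proof.
have [->|y0] := eqVneq y 0; first by rewrite raddf0 !normr0 mulr0.
have ny : 0 < `|y| by rewrite normr_gt0.
rewrite -ler_pdivrMr// mulrC.
apply: ub_le_sup; first exact: opnorm_has_ubound.
exists (`|y|^-1 *: y) => /=.
  by rewrite normrZ ger0_norm ?invr_ge0// mulVf// gt_eqF.
by rewrite linearZ/= normrZ ger0_norm ?invr_ge0.
Qed.

End operator_norm.

(** * Step sizes decaying like a power *)

Section power_steps.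
Context (R : realType) (A t : R).
Hypotheses (A0 : 0 < A) (t0 : 0 < t) (t1 : t < 1).

Let step (m : nat) : R := A / (m.+1%:R `^ t).

Lemma power_step_gt0 m : 0 < step m.
Proof. by rewrite divr_gt0// powR_gt0. Qed.

Lemma power_step_le m : step m <= A.
Proof.
rewrite ler_pdivrMr ?powR_gt0// ler_peMr ?(ltW A0)//.
have := @ler_powR R m.+1%:R; rewrite ler1n => /(_ erefl 0 t (ltW t0)).
by rewrite powRr0.
Qed.

Lemma power_step_noninc m : step m.+1 <= step m.
Proof.
rewrite ler_wpM2l ?(ltW A0)// lef_pV2 ?posrE ?powR_gt0//.
by rewrite ge0_ler_powR ?nnegrE ?(ltW t0)// ler_nat.
Qed.

(** The product is A (m+1)^(1-t), which diverges because t < 1. *)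
Lemma power_step_slow : (m.+1%:R * step m)^-1 @[m --> \oo] --> (0 : R).
Proof.
have s0 : 0 < 1 - t by rewrite subr_gt0.
have E m : (m.+1%:R * step m)^-1 = A^-1 * (m.+1%:R `^ (1 - t))^-1 :> R.
  rewrite /step powRB ?pnatr_eq0 ?implybT// powRr1//.
  by rewrite !invfM !invrK mulrCA.
under eq_fun do rewrite E.
rewrite -(mulr0 A^-1); apply: cvgM; first exact: cvg_cst.
apply/cvgrPdist_le => e' e0; move: (e' : R) e0 => e e0.
(* Solving (m+1)^(1-t) >= 1/e for m+1; the shift by one absorbs the truncation. *)
exists (Num.trunc (e^-1 `^ (1 - t)^-1)) => // m /= Nm.
rewrite sub0r normrN ger0_norm ?invr_ge0 ?powR_ge0//.
rewrite -[leRHS]invrK lef_pV2 ?posrE ?invr_gt0 ?powR_gt0//.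
have -> : e^-1 = (e^-1 `^ (1 - t)^-1) `^ (1 - t).
  by rewrite -powRrM mulVf ?gt_eqF// powRr1// invr_ge0 ltW.
rewrite ge0_ler_powR ?nnegrE ?powR_ge0 ?(ltW s0)//.
have /andP[_ h] := Num.Theory.truncn_itv (powR_ge0 e^-1 (1 - t)^-1).
by rewrite (le_trans (ltW h))// ler_nat ltnS.
Qed.

End power_steps.

(** * Reduction of the stochastic problem to the deterministic iteration *)

Theorem mainTheorem2 (R : realType)
    (Y V : completeNormedModType R)
    (ipY : {dot Y for idfun}) (ipV : {dot V for idfun})
    (hilbY : hilbert_norm ipY) (hilbV : hilbert_norm ipV)
    (sepY : separable Y) (sepV : separable V)
    (infV : infinite_dimensional V)
    (Omega : pmetricType R) (compactOmega : compact [set: Omega])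
    (mu : probability (borel (Omega * Y)%type) R)
    (mu_y2 : (\int[mu]_z (`|z.2| ^+ 2)%:E < +oo)%E)
    (Rop : Omega -> {linear Y -> V})
    (Rop_bounded : forall w, continuous (Rop w))
    (Rop_weak_meas : forall (y : Y) (v : V),
      measurable_fun [set: borel Omega] (fun w : borel Omega => ipV (Rop w y) v))
    (Lambda : R) (Rop_le : forall w, opnorm (Rop w) ^+ 2 <= Lambda)
    (Radj : Omega -> V -> Y)
    (Radj_adjoint : forall w, is_adjoint ipY ipV (Rop w) (Radj w))
    (Prho : {linear V -> V})
    (Prho_mean : is_mean_operator ipY ipV (marginal mu) Radj Prho)
    (Prho_inj : injective Prho) (Prho_compact : compact_operator Prho)
    (g_notin : ~ range Prho (bochner mu (fun z => Rop z.1 z.2)))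
    (d : measure_display) (T : measurableType d) (P : probability T R)
    (z : nat -> {RV P >-> borel (Omega * Y)%type})
    (z_iid : iid P mu z)
    (u0 : V) (t A : R)
    (t_gt : 1 / 2 < t) (t_lt : t < 1)
    (A_gt : 0 < A) (A_le : A <= 1 / (2 * Lambda)) :
  let alpha := fun m : nat => m.+1%:R / m.+2%:R in
  let step := fun m : nat => A / (m.+1%:R `^ t) in
  let u := fun (m : nat) (s : T) =>
    iterates Rop Radj alpha step u0 (fun k => z k s) m in
  `|bochner P (u m)| ^+ 2 @[m --> \oo] --> +oo_R.
Proof.
move=> alpha step u.
(* Positivity is read off from 0 < A <= 1/(2 Lambda). *)
have L0 : 0 < Lambda.
  have : 0 < 1 / (2 * Lambda) by exact: lt_le_trans A_le.
  by rewrite div1r invr_gt0 pmulr_rgt0.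
have Rop_bound w y : `|Rop w y| <= opnorm (Rop w) * `|y| by exact: opnorm_le.
have op0 w : 0 <= opnorm (Rop w) by exact: opnorm_ge0.
(* With R the operator at [w], the adjoint relation gives |R^* v|^2 = <R R^* v, v> <= |R| |R^* v|
   |v|. *)
have Radj_bound w v : `|Radj w v| <= opnorm (Rop w) * `|v|.
  have [->|n0] := eqVneq (`|Radj w v|) 0; first by rewrite mulr_ge0.
  have n1 : 0 < `|Radj w v| by rewrite lt_def n0/=.
  rewrite -(ler_pM2l n1) -expr2 -hilbY -Radj_adjoint.
  rewrite (le_trans (ip_le hilbV _ _))// mulrA ler_wpM2r// mulrC.
  exact: Rop_bound.
have K_linear (s : borel (Omega * Y)%type) :
    linear (fun v => Rop s.1 (Radj s.1 v) : V).
  move=> a v w; rewrite -linearP; congr (Rop s.1 _).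
  apply: (ip_ext hilbY) => y; rewrite ipDl ipZl !(ipC _ y) -!Radj_adjoint.
  by rewrite ipDr ipZr.
pose K (s : borel (Omega * Y)%type) : {linear V -> V} :=
  HB.pack (fun v => Rop s.1 (Radj s.1 v) : V)
    (GRing.isLinear.Build R V V *:%R _ (K_linear s)).
have K_ip s v w : ipV (K s v) w = ipY (Radj s.1 v) (Radj s.1 w).
  exact: Radj_adjoint.
have K_bounded s v : `|K s v| <= Lambda * `|v|.
  rewrite (le_trans (Rop_bound _ _))//.
  rewrite (le_trans (ler_wpM2l (op0 _) (Radj_bound _ _)))//.
  by rewrite mulrA -expr2 ler_wpM2r.
have mfst : measurable_fun [set: borel (Omega * Y)%type]
    (fst : borel (Omega * Y)%type -> borel Omega).
  apply: preimage_generator_measurable => B.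
  apply: (continuousP (fst : (Omega * Y)%type -> Omega)).1 => s; exact: cvg_fst.
(* The adjoint is weakly measurable since its pairing with [y] is the pairing of [Rop w y] with [v];
   Pettis then applies in [Y]. *)
have Radj_norm_meas v e : measurable_fun [set: borel Omega]
    (fun w : borel Omega => `|Radj w v - e|).
  apply: (weakly_measurable_norm hilbY sepY).
  apply: weakly_measurableB; last exact: (weakly_measurable_cst ipY e).
  move=> y; under eq_fun do rewrite ipC -Radj_adjoint.
  exact: Rop_weak_meas.
have Rop_ip_cont w v : continuous (fun y => ipV (Rop w y) v).
  move=> y; apply: (@continuous_comp _ _ _ (Rop w) (ipV^~ v)).
    exact: Rop_bounded.
  exact: ip_continuous.
have RR_meas v w : measurable_fun [set: borel Omega]
    (fun w' : borel Omega => ipV (Rop w' (Radj w' v)) w).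
  apply: (measurable_caratheodory (T := borel Omega) (f := Radj^~ v)
    (h := fun w' y => ipV (Rop w' y) w) sepY).
  - exact: Radj_norm_meas.
  - by move=> y; exact: Rop_weak_meas.
  - by move=> w'; exact: Rop_ip_cont.
have K_meas v : weakly_measurable ipV (K^~ v).
  by move=> w; exact: (measurableT_comp (RR_meas v w) mfst).
have K_int v w : mu.-integrable setT (EFin \o (fun s => ipV (K s v) w)).
  exact: (norm_integrable_ip hilbV w
    (norm_integrable_operator_cst hilbV sepV mu K_bounded K_meas v)).
(* The integral over the marginal is pulled back to [mu] along the first projection. *)
have P_mean v w : ipV (Prho v) w = \int[mu]_s ipV (K s v) w.
  have := Prho_mean v w; rewrite /marginal (integral_pushforward mfst)//.
  - rewrite /Rintegral preimage_setT => E; rewrite -[LHS]/(fine (ipV (Prho v) w)%:E).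
    by rewrite E; congr fine; apply: eq_integral => s _; rewrite K_ip.
  - apply/measurable_EFinP => /=.
    have -> : (fun w' : borel Omega => ipY (Radj w' v) (Radj w' w)) =
        (fun w' : borel Omega => ipV (Rop w' (Radj w' v)) w).
      by apply/funext => w'; rewrite Radj_adjoint.
    exact: RR_meas.
  - apply: eq_integrable (K_int v w) => // s _.
    by rewrite /= Radj_adjoint.
have P_sym v w : ipV (Prho v) w = ipV v (Prho w).
  by rewrite (ipC v) !P_mean; apply: eq_Rintegral => s _; rewrite !K_ip ipC.
have P_pos v : 0 <= ipV (Prho v) v.
  by rewrite P_mean; apply: Rintegral_ge0 => s _; rewrite K_ip ip_ge0.
have P_bound v : `|Prho v| <= Lambda * `|v|.
  have Kv := norm_integrable_operator_cst hilbV sepV mu K_bounded K_meas v.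
  apply: le_trans (weak_mean_norm_le hilbV Kv (P_mean v)) _.
  have cL : mu.-integrable setT (EFin \o (fun=> Lambda * `|v|)).
    exact: (finite_measure_integrable_cst mu (Lambda * `|v|) measurableT).
  apply: (@le_trans _ _ (\int[mu]_s (Lambda * `|v|))).
    by apply: le_Rintegral => //; case: Kv.
  rewrite (@Rintegral_cst _ _ _ mu setT measurableT) [X in fine X]probability_setT.
  by rewrite mulr1.
pose psi (s : borel (Omega * Y)%type) : V := Rop s.1 s.2.
have snd_meas (e : Y) : measurable_fun [set: borel (Omega * Y)%type]
    (fun s : borel (Omega * Y)%type => `|s.2 - e|).
  apply: preimage_open_measurable => B.
  apply: (continuousP (fun s : (Omega * Y)%type => `|s.2 - e|)).1 => s.
  by apply: cvg_norm; apply: cvgB; [exact: cvg_snd|exact: cvg_cst].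
have psi_meas : weakly_measurable ipV psi.
  move=> v; apply: (measurable_caratheodory (T := borel (Omega * Y)%type)
    (f := fun s : borel (Omega * Y)%type => s.2)
    (h := fun s y => ipV (Rop s.1 y) v) sepY).
  - exact: snd_meas.
  - by move=> y; exact: (measurableT_comp (Rop_weak_meas y v) mfst).
  - by move=> s; exact: Rop_ip_cont.
have y2_int : mu.-integrable setT
    (EFin \o (fun s : borel (Omega * Y)%type => `|s.2| ^+ 2)).
  apply/integrableP; split.
    apply/measurable_EFinP; apply: measurable_funX.
    by have := snd_meas 0; under eq_fun do rewrite subr0.
  under eq_integral do rewrite /= ger0_norm//.
  exact: mu_y2.
(* The dominating function is (1 + Lambda)(1 + |y|^2), by c <= 1 + c^2 applied to the operator norm
   and to |y|. *)
have psi_int : norm_integrable ipV mu psi.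
  have b_int := integrable_scale (1 + Lambda) (integrable_add
    (finite_measure_integrable_cst mu 1 measurableT) y2_int).
  apply: (norm_integrable_le hilbV sepV psi_meas b_int) => s.
  rewrite (le_trans (Rop_bound _ _))// ler_pM//.
    have := Rop_le s.1; have := sqr_ge0 (opnorm (Rop s.1) - 1).
    rewrite sqrrB1; move: (_ ^+ 2) => c; lra.
  have := sqr_ge0 (`|s.2| - 1); rewrite sqrrB1 /=; have := normr_ge0 s.2.
  move: (_ ^+ 2) => c; lra.
have u_cst : exists c, u 0%N = cst c by exists u0.
have uS m s : u m.+1 s = alpha m *: (u m s + step m *:
    (psi (z m s) - K (z m s) (u m s))).
  by rewrite /u /= -raddfB.
have t0 : 0 < t by rewrite (lt_trans _ t_gt).
apply: (@averaged_iteration_unbounded _ _ ipV hilbV Prho Lambda L0 P_sym P_pos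
  P_bound (bochner mu psi) step (fun m => bochner P (u m))) => //.
- exact: power_step_gt0.
(* Each step is at most A, and A Lambda <= 1/2. *)
- move=> m; rewrite (@le_trans _ _ (A * Lambda))//.
    by rewrite ler_wpM2r ?(ltW L0)// power_step_le.
  rewrite (le_trans (ler_wpM2r (ltW L0) A_le))// div1r invfM -mulrA mulVf ?gt_eqF//.
  by rewrite mulr1 invf_le1// ler1n.
- exact: power_step_noninc.
- exact: power_step_slow.
- move=> m.
  exact: (bochner_iterates hilbV sepV z_iid K_bounded K_meas P_mean P_sym psi_int
    u_cst uS).
Qed.
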